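(* Let $1<p\le q<\infty$ and $1\le r,s\le\infty$. (i) One has $A_{p,q}\subset A_{(p,r),(q,s)}$. (ii) If $s\le q$ and $r\ge p$, then $A_{(p,r),(q,s)}=A_{p,q}$.
   Context: A weight is a measurable function on $\mathbb R^d$ with values in $(0,\infty)$ almost everywhere. For a measurable $f$ on $\mathbb R^d$ with decreasing rearrangement $f^*$, $\|f\|_{L^{a,b}}:=\big(\frac ba\int_0^\infty[t^{1/a}f^*(t)]^b\frac{dt}t\big)^{1/b}$ for $0<a,b<\infty$, and $\|f\|_{L^{a,\infty}}:=\sup_{t>0}t^{1/a}f^*(t)$. For a cube $Q$ (sides parallel to the axes), $\|h\|_{L^{a,b}(Q)}:=|Q|^{-1/a}\|h\mathbf 1_Q\|_{L^{a,b}}$. Primes denote conjugate exponents, $1'=\infty$, $\infty'=1$. A weight $w$ on $\mathbb R^d$ belongs to $A_{(p,r),(q,s)}$ if $\sup_Q\|w\|_{L^{q,s}(Q)}\|w^{-1}\|_{L^{p',r'}(Q)}<\infty$, and to $A_{p,q}$ if $\sup_Q\big(\frac1{|Q|}\int_Qw^q\big)^{1/q}\big(\frac1{|Q|}\int_Qw^{-p'}\big)^{1/p'}<\infty$; suprema are over all cubes $Q\subset\mathbb R^d$. *)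

(* Defs.v *)
From HB Require Import structures.
From mathcomp Require Import all_boot all_order all_algebra.
From mathcomp Require Import all_classical all_reals all_analysis.
From mathcomp Require Import measurable_realfun.

Set Implicit Arguments.
Unset Strict Implicit.
Unset Printing Implicit Defensive.

Import Order.TTheory GRing.Theory Num.Theory.
Import numFieldNormedType.Exports.

Local Open Scope classical_set_scope.
Local Open Scope ring_scope.
Local Open Scope ereal_scope.

Section tuple_measure.
Context {R : realType}.
Let T := measurableTypeR R.

Definition tcons n (p : T * n.-tuple T) : n.+1.-tuple T := [tuple of p.1 :: p.2].

Lemma measurable_tcons n : measurable_fun [set: T * n.-tuple T] (@tcons n).
Proof. by apply: measurable_cons. Qed.

Lemma tcons_inj n : injective (@tcons n).
Proof. by move=> [x s] [y t] /(congr1 val) [-> /val_inj ->]. Qed.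

Section lebesgue_cons.
Context (n : nat) (m : {sigma_finite_measure set (n.-tuple T) -> \bar R}).

Definition lebesgue_cons : set (n.+1.-tuple T) -> \bar R :=
  pushforward (@lebesgue_measure R \x m) (@tcons n).

Let lebesgue_cons0 : lebesgue_cons set0 = 0.
Proof. by rewrite /lebesgue_cons /pushforward preimage_set0 measure0. Qed.

Let lebesgue_cons_ge0 A : 0 <= lebesgue_cons A.
Proof. by apply: integral_ge0 => x _; exact: measure_ge0. Qed.

Let lebesgue_cons_sigma_additive : semi_sigma_additive lebesgue_cons.
Proof.
move=> F mF tF mUF; rewrite /lebesgue_cons /pushforward preimage_bigcup.
have mtcons A : measurable A -> measurable (@tcons n @^-1` A).
  by move=> mA; rewrite -[X in measurable X]setTI; exact: measurable_tcons.
apply: measure_semi_sigma_additive.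
- by move=> k; exact: mtcons.
- apply/trivIsetP => /= i j _ _ ij; rewrite -preimage_setI.
  by move/trivIsetP : tF => /(_ _ _ _ _ ij) ->//; rewrite preimage_set0.
- by rewrite -preimage_bigcup; exact: mtcons.
Qed.

HB.instance Definition _ := isMeasure.Build _ _ _ lebesgue_cons
  lebesgue_cons0 lebesgue_cons_ge0 lebesgue_cons_sigma_additive.

Let lebesgue_cons_sigma_finite : sigma_finite setT lebesgue_cons.
Proof.
have /sigma_finiteP[F [TF ndF Foo]] := sigma_finiteT (@lebesgue_measure R).
have /sigma_finiteP[G [TG ndG Goo]] := sigma_finiteT m.
pose h (t : n.+1.-tuple T) : n.-tuple T := [tuple of behead t].
have hK (p : T * n.-tuple T) : h (tcons p) = p.2 by exact/val_inj.
exists (fun k => (fun t => tnth t ord0) @^-1` F k `&` h @^-1` G k).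
  apply/esym; rewrite -subTset => t _.
  have : (\bigcup_k F k) (tnth t ord0) by rewrite -TF.
  have : (\bigcup_k G k) (h t) by rewrite -TG.
  move=> [j _ Gjt] [i _ Fit]; exists (maxn i j) => //; split => /=.
    by move: Fit; exact/subsetPset/ndF/leq_maxl.
  by move: Gjt; exact/subsetPset/ndG/leq_maxr.
move=> k; have [mF Fk] := Foo k; have [mG Gk] := Goo k; split.
  apply: measurableI; rewrite -[X in measurable X]setTI.
    exact: measurable_tnth.
  exact: measurable_behead.
rewrite /lebesgue_cons /pushforward (_ : _ @^-1` _ = F k `*` G k).
  by rewrite product_measure1E// lte_mul_pinfty// ge0_fin_numE.
by apply/seteqP; split => p /=; rewrite hK.
Qed.

HB.instance Definition _ := Measure_isSigmaFinite.Build _ _ _ lebesgue_cons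
  lebesgue_cons_sigma_finite.

End lebesgue_cons.

(* Lebesgue measure on the Borel sets of R^n, by iterated product *)
Fixpoint lebesgue_tuple n : {sigma_finite_measure set (n.-tuple T) -> \bar R} :=
  match n with
  | 0%N => \d_([tuple] : 0.-tuple T)
  | n'.+1 => lebesgue_cons (lebesgue_tuple n')
  end.

Lemma lebesgue_tuple_box n (A : 'I_n -> set T) :
  (forall i, measurable (A i)) ->
  lebesgue_tuple n [set x | forall i, A i (tnth x i)] =
  \prod_(i < n) lebesgue_measure (A i).
Proof.
elim: n A => [|n IHn] A mA /=.
  rewrite big_ord0 diracE mem_set//=; by case.
rewrite /lebesgue_cons /pushforward (_ : _ @^-1` _ =
    A ord0 `*` [set x | forall i, A (lift ord0 i) (tnth x i)]); last first.
  apply/seteqP; split=> [[x s] /= xsA|[x s] /= [xA sA] i].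
    split; first by have := xsA ord0.
    by move=> i; have := xsA (lift ord0 i); rewrite tnthS.
  by case: (unliftP ord0 i) => [j ->|->]; rewrite ?tnthS.
rewrite product_measure1E//; first by rewrite big_ord_recl -IHn.
rewrite (_ : [set _ | _] = \bigcap_(i in [set: 'I_n])
  ((fun x : n.-tuple T => tnth x i) @^-1` A (lift ord0 i))); last first.
  by apply/seteqP; split => x /= xA i; [move=> _; exact: xA|exact: (xA i)].
apply: fin_bigcap_measurable => // i _.
by rewrite -[X in measurable X]setTI; exact: measurable_tnth.
Qed.

End tuple_measure.

(* The carrier of [Rd R d] is [d.-tuple R]; its measurable sets are the
   Lebesgue measurable ones, not only the Borel ones. *)
Definition Rd (R : realType) (d : nat) : measurableType _ :=
  caratheodory_type (mu_ext (@lebesgue_tuple R d)).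

Definition lebesgue_Rd (R : realType) (d : nat) :
    {measure set (Rd R d) -> \bar R} :=
  @completed_measure_extension _ _ _ (@lebesgue_tuple R d).

Section lorentz.
Context d (T : measurableType d) (R : realType).
Variable mu : {measure set T -> \bar R}.
Implicit Types (f : T -> \bar R) (a t : R) (b : \bar R).

Definition decr_rearr f t : \bar R :=
  ereal_inf [set y | 0 <= y /\ mu [set x | y < `|f x|] <= t%:E].

Definition lorentz_norm a b f : \bar R :=
  match b with
  | b'%:E =>
      ((b' / a)%:E *
       \int[lebesgue_measure]_(t in `]0%R, +oo[)
         (((t `^ a^-1)%:E * decr_rearr f t) `^ b' * (t^-1)%:E)) `^ b'^-1
  | +oo =>
      ereal_sup [set (t `^ a^-1)%:E * decr_rearr f t | t in `]0%R, +oo[]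
  | -oo => 0 (* junk *)
  end.

Definition lorentz_avg (Q : set T) a b f : \bar R :=
  mu Q `^ (- a^-1) * lorentz_norm a b (f \_ Q).

End lorentz.

Section weights.
Context (R : realType) (d : nat).
Local Notation mu := (lebesgue_Rd R d).

Definition cube : set (set (Rd R d)) :=
  [set Q | exists (c : d.-tuple R) (l : R), (0 < l)%R /\
    Q = [set x : d.-tuple R |
          forall i, (tnth c i <= tnth x i <= tnth c i + l)%R]].

Definition weight : set (Rd R d -> \bar R) :=
  [set w : Rd R d -> \bar R | measurable_fun [set: Rd R d] w /\
    {ae mu, forall x, 0 < w x < +oo}].

(* real-valued conjugate exponent, for 1 < p < oo *)
Definition conj_exp (p : R) : R := fine (hoelder_conjugate p%:E).

Definition A_lorentz (p : R) (r : \bar R) (q : R) (s : \bar R) :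
    set (Rd R d -> \bar R) :=
  [set w : Rd R d -> \bar R | weight w /\
    ereal_sup [set lorentz_avg mu Q q s w *
        lorentz_avg mu Q (conj_exp p) (hoelder_conjugate r) (fun x => (w x)^-1)
      | Q in cube] < +oo].

Definition A_pq (p q : R) : set (Rd R d -> \bar R) :=
  [set w : Rd R d -> \bar R | weight w /\
    ereal_sup [set
        ((mu Q)^-1 * \int[mu]_(x in Q) w x `^ q) `^ q^-1 *
        ((mu Q)^-1 * \int[mu]_(x in Q) w x `^ (- conj_exp p))
          `^ (conj_exp p)^-1
      | Q in cube] < +oo].

End weights.

(* Main.v *)
(* Both inclusions reduce to comparing, on each cube [Q], the average
   [(|Q|^-1 int_Q v^a)^(1/a)] of a positive real function [v] with its
   normalized Lorentz norm [L^{a,b}(Q)]; this is applied to [v = w], [a = q] and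
   to [v = w^-1], [a = p'].

   Lower bound for [b <= a]: the decreasing rearrangement [g] of [v 1_Q] satisfies
   [t^(1/a) g(t) <= C ||g||_{a,b}]; inserting this in [int_Q v^a = int g^a]
   leaves the integral defining [||g||_{a,b}^b].

   Upper bound for all [b >= 1], under the [A_{p,q}] condition: [nu = v^a dx]
   satisfies an A_infinity condition.  A subset of a cube with small Lebesgue
   density has [nu]-density at most [beta < 1] (Chebyshev on [v^-b]), and a
   Calderon-Zygmund stopping time on dyadic subcubes iterates this to
   [nu(E) <= C (|E| / |Q|)^delta nu(Q)].  The stopping argument is run on finite
   unions of dyadic cubes, where it needs no differentiation theorem, and
   extended to measurable [E] by approximation.  For level sets [E] of [v] it
   reads [g(t) <= C avg (t / |Q|)^(-(1 - delta) / a)], and such a power is in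
   [L^{a,b}(0, |Q|)] for every [b]. *)
From HB Require Import structures.
Require Import Defs.
From mathcomp Require Import all_boot all_order all_algebra.
From mathcomp Require Import all_classical all_reals all_analysis.
From mathcomp Require Import measurable_realfun ring lra.

Set Implicit Arguments.
Unset Strict Implicit.
Unset Printing Implicit Defensive.

Import Order.TTheory GRing.Theory Num.Theory.
Import numFieldNormedType.Exports.

Local Open Scope classical_set_scope.
Local Open Scope ring_scope.
Local Open Scope ereal_scope.

(** * Cubes and their dyadic children *)

Lemma ler_powRN (R : realType) (x y p : R) : (0 <= p)%R -> (0 < x)%R ->
  (x <= y)%R -> (y `^ (- p) <= x `^ (- p))%R.
Proof.
move=> p0 x0 xy; have y0 := lt_le_trans x0 xy.
by rewrite !powRN lef_pV2 ?posrE ?powR_gt0// ge0_ler_powR// nnegrE ltW.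
Qed.

Section boxes.
Context (R : realType) (d : nat).
Local Notation mu := (lebesgue_Rd R d).
Local Notation T := (d.-tuple (measurableTypeR R)).

Lemma borel_measurable_Rd (A : set T) :
  measurable A -> measurable (A : set (Rd R d)).
Proof. by move=> mA; exact: caratheodory_measurable_mu_ext. Qed.

Lemma lebesgue_RdE (A : set T) : measurable A -> mu A = lebesgue_tuple d A.
Proof. by move=> mA; exact: measurable_mu_extE. Qed.

Definition box (A : 'I_d -> set (measurableTypeR R)) : set T :=
  [set x | forall i, A i (tnth x i)].

Lemma measurable_box A : (forall i, measurable (A i)) -> measurable (box A).
Proof.
move=> mA; rewrite (_ : box A = \bigcap_(i in [set: 'I_d])
    ((fun x : T => tnth x i) @^-1` A i)); last first.
  by apply/seteqP; split => x /= xA i; [move=> _; exact: xA|exact: (xA i)].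
apply: fin_bigcap_measurable => // i _.
by rewrite -[X in measurable X]setTI; exact: measurable_tnth.
Qed.

Lemma lebesgue_Rd_box A : (forall i, measurable (A i)) ->
  mu (box A) = \prod_(i < d) lebesgue_measure (A i).
Proof.
move=> mA; rewrite lebesgue_RdE; last exact: measurable_box.
exact: lebesgue_tuple_box.
Qed.

(** Half-open cubes are partitioned exactly by their dyadic children. The closed cubes [ccube] of
    the weight classes exceed them only by null faces. *)
Definition hcube (c : d.-tuple R) (l : R) : set (Rd R d) :=
  [set x : d.-tuple R | forall i, (tnth c i < tnth x i <= tnth c i + l)%R].

Definition ccube (c : d.-tuple R) (l : R) : set (Rd R d) :=
  [set x : d.-tuple R | forall i, (tnth c i <= tnth x i <= tnth c i + l)%R].

Let prodl (l : R) : \prod_(i < d) l%:E = (l ^+ d)%:E.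
Proof. by rewrite prodEFin prodr_const card_ord. Qed.

Lemma hcubeE c l : hcube c l = box (fun i => `]tnth c i, (tnth c i + l)%R]%classic).
Proof.
by apply/seteqP; split => x /= xQ i; have := xQ i; rewrite /= in_itv.
Qed.

Lemma ccubeE c l : ccube c l = box (fun i => `[tnth c i, (tnth c i + l)%R]%classic).
Proof.
by apply/seteqP; split => x /= xQ i; have := xQ i; rewrite /= in_itv.
Qed.

Lemma measurable_hcube c l : measurable (hcube c l).
Proof.
by rewrite hcubeE; apply: borel_measurable_Rd; apply: measurable_box => i;
  exact: measurable_itv.
Qed.

Lemma measurable_ccube c l : measurable (ccube c l).
Proof.
by rewrite ccubeE; apply: borel_measurable_Rd; apply: measurable_box => i;
  exact: measurable_itv.
Qed.

Lemma lebesgue_hcube c l : (0 < l)%R -> mu (hcube c l) = (l ^+ d)%:E.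
Proof.
move=> l0; rewrite hcubeE lebesgue_Rd_box; last by move=> i; exact: measurable_itv.
rewrite -prodl; apply: eq_bigr => i _.
rewrite lebesgue_measure_itv/= lte_fin ltrDl l0 -EFinD; congr EFin.
by rewrite addrAC subrr add0r.
Qed.

Lemma lebesgue_ccube c l : (0 < l)%R -> mu (ccube c l) = (l ^+ d)%:E.
Proof.
move=> l0; rewrite ccubeE lebesgue_Rd_box; last by move=> i; exact: measurable_itv.
rewrite -prodl; apply: eq_bigr => i _.
rewrite lebesgue_measure_itv/= lte_fin ltrDl l0 -EFinD; congr EFin.
by rewrite addrAC subrr add0r.
Qed.

Lemma sub_hcube_ccube c l : hcube c l `<=` ccube c l.
Proof. by move=> x xQ i; have /andP[/ltW -> ->] := xQ i. Qed.

Lemma ccubeD_null c l : (0 < l)%R -> mu (ccube c l `\` hcube c l) = 0.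
Proof.
move=> l0; rewrite measureD/=; last first.
- by rewrite [ltLHS]lebesgue_ccube// ltry.
- exact: measurable_hcube.
- exact: measurable_ccube.
rewrite setIidr; last exact: sub_hcube_ccube.
by rewrite [X in X - _]lebesgue_ccube// [X in _ - X]lebesgue_hcube// subee.
Qed.

(** The [2 ^+ d] children are indexed by the choice, on each axis, of the lower or the upper
    half. *)
Definition child (c : d.-tuple R) (l : R) (e : {ffun 'I_d -> bool}) : d.-tuple R :=
  [tuple (tnth c i + (if e i then l / 2 else 0))%R | i < d].

Lemma hcube_split c l : (0 < l)%R ->
  hcube c l = \bigcup_e hcube (child c l e) (l / 2)%R.
Proof.
move=> l0; apply/seteqP; split => [x xQ|x].
  exists [ffun i => (tnth c i + l / 2 < tnth x i)%R] => //.
  move=> i; rewrite tnth_mktuple ffunE; have /andP[h1 h2] := xQ i.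
  by case: (ltP (tnth c i + l / 2)%R (tnth x i)) => h; apply/andP; split; lra.
move=> [e _ xe] i; have := xe i; rewrite tnth_mktuple.
by case: (e i) => /andP[h1 h2]; apply/andP; split; lra.
Qed.

Lemma trivIset_child c l (D : set {ffun 'I_d -> bool}) : (0 < l)%R ->
  trivIset D (fun e => hcube (child c l e) (l / 2)%R).
Proof.
move=> l0 e1 e2 _ _ [x [x1 x2]]; apply/ffunP => i.
have := x1 i; have := x2 i; rewrite !tnth_mktuple.
by case: (e1 i) => //; case: (e2 i) => // /andP[h1 h2] /andP[h3 h4]; exfalso; lra.
Qed.

Lemma sub_child c l e : (0 < l)%R -> hcube (child c l e) (l / 2)%R `<=` hcube c l.
Proof. by move=> l0 x xe; rewrite hcube_split//; exists e. Qed.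

End boxes.

(** * Dyadic sets and stopping cubes *)

Section dyadic.
Context (R : realType) (d : nat).
Local Notation mu := (lebesgue_Rd R d).
Implicit Types (c : d.-tuple R) (l : R) (E F : set (Rd R d)) (n : nat).

(** Inside the half-open cube, [E] is a union of dyadic subcubes of generation [n]: after [n]
    halvings each subcube is full or empty. Only the trace of [E] on the cube matters. *)
Fixpoint dyadic n c l E : Prop :=
  match n with
  | 0%N => hcube c l `<=` E \/ E `&` hcube c l = set0
  | n'.+1 => forall e, dyadic n' (child c l e) (l / 2)%R E
  end.

Lemma dyadic_eq n c l E F : (0 < l)%R -> E `&` hcube c l = F `&` hcube c l ->
  dyadic n c l E -> dyadic n c l F.
Proof.
elim: n c l => [|n IH] c l l0 EF /=.
  case=> [HE|E0]; [left|right; by rewrite -EF].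
  by apply/setIidPr; rewrite -EF; exact/setIidPr.
move=> DE e; apply: IH (DE e); first by rewrite divr_gt0.
have := congr1 (setI^~ (hcube (child c l e) (l / 2))) EF.
by rewrite /= -!setIA (setIidr (@sub_child _ _ c l e l0)).
Qed.

Lemma dyadic_full n c l E : (0 < l)%R -> hcube c l `<=` E -> dyadic n c l E.
Proof.
elim: n c l => [|n IH] c l l0 HE /=; first by left.
move=> e; apply: IH; first by rewrite divr_gt0.
exact: subset_trans (sub_child l0) HE.
Qed.

Lemma dyadic_empty n c l E : (0 < l)%R -> E `&` hcube c l = set0 -> dyadic n c l E.
Proof.
elim: n c l => [|n IH] c l l0 HE /=; first by right.
move=> e; apply: IH; first by rewrite divr_gt0.
by apply/seteqP; split => // x [Ex /(sub_child l0) Hx]; rewrite -HE.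
Qed.

Lemma dyadicS n c l E : (0 < l)%R -> dyadic n c l E -> dyadic n.+1 c l E.
Proof.
elim: n c l => [|n IH] c l l0.
  by case=> [/(dyadic_full 1 l0)|/(dyadic_empty 1 l0)].
by move=> DE e; apply: IH; [rewrite divr_gt0|exact: DE].
Qed.

Lemma dyadic_le m n c l E : (0 < l)%R -> (m <= n)%N ->
  dyadic m c l E -> dyadic n c l E.
Proof.
move=> l0 /subnK <-; elim: (n - m)%N => // k IH DE.
by rewrite addSn; apply: dyadicS => //; exact: IH.
Qed.

Lemma dyadicC n c l E : dyadic n c l E -> dyadic n c l (~` E).
Proof.
elim: n c l => [|n IH] c l /=; last by move=> DE e; exact: IH.
case=> [HE|E0]; [right|left].
- by apply/seteqP; split => // x [nE] /HE.
- by move=> x Hx Ex; have : (E `&` hcube c l) x by []; rewrite E0.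
Qed.

Lemma dyadicU n c l E F : dyadic n c l E -> dyadic n c l F ->
  dyadic n c l (E `|` F).
Proof.
elim: n c l => [|n IH] c l /=; last by move=> DE DF e; exact: IH.
move=> [HE _|E0 [HF|F0]].
- by left; apply: subset_trans HE _; exact: subsetUl.
- by left; apply: subset_trans HF _; exact: subsetUr.
- by right; rewrite setIUl E0 F0 setU0.
Qed.

Lemma measure_children (m : {measure set (Rd R d) -> \bar R}) c l E :
  (0 < l)%R -> measurable E ->
  m (E `&` hcube c l) =
  \sum_(e \in [set: {ffun 'I_d -> bool}])
     m (E `&` hcube (child c l e) (l / 2)%R).
Proof.
move=> l0 mE; rewrite hcube_split// setI_bigcupr measure_fin_bigcup//.
- exact: finite_finset.
- by apply: trivIset_setIl; exact: trivIset_child.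
- by move=> e _; apply: measurableI => //; exact: measurable_hcube.
Qed.

Variables (nu : {measure set (Rd R d) -> \bar R}) (al be : R).
Hypotheses (al0 : (0 < al)%R) (al1 : (2 ^+ d * al < 1)%R) (be0 : (0 <= be)%R).
Hypothesis nu_small : forall c l E, (0 < l)%R -> measurable E ->
  E `<=` hcube c l -> mu E <= (2 ^+ d * al)%:E * mu (hcube c l) ->
  nu E <= be%:E * nu (hcube c l).

(* Calderon-Zygmund stopping: [F] is the union of the maximal dyadic subcubes
   in which [E] has density more than [al]; as their parents have density at
   most [al], they satisfy the hypothesis of [nu_small]. *)
Lemma stopping_cubes n c l E : (0 < l)%R -> measurable E -> dyadic n c l E ->
  mu (E `&` hcube c l) <= (2 ^+ d * al)%:E * mu (hcube c l) ->
  exists F, [/\ measurable F, F `<=` hcube c l, dyadic n c l F,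
    al%:E * mu F <= mu (E `&` hcube c l) &
    nu (E `&` hcube c l) <= be%:E * nu F].
Proof.
move=> l0 mE; elim: n c l l0 => [|n IH] c l l0 DE Eal.
  case: DE => [HE|E0]; last first.
    exists set0; split => //; first by right; rewrite set0I.
      by rewrite measure0 mule0.
    by rewrite E0 !measure0 mule0.
  (* A nonempty trace at generation 0 has density 1, which exceeds [2 ^+ d * al]. *)
  exfalso; move: Eal; rewrite (setIidr HE) lebesgue_hcube//.
  rewrite -EFinM lee_fin -{1}[(l ^+ d)%R]mul1r ler_pM2r ?exprn_gt0//.
  by rewrite leNgt al1.
have mH := @measurable_hcube R d c l.
have [Esmall|Ebig] := leP (mu (E `&` hcube c l)) (al%:E * mu (hcube c l));
    last first.
  (* Density above [al]: the cube itself is selected, and the assumed bound [2 ^+ d * al] is what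
     [nu_small] asks for. *)
  exists (hcube c l); split => //.
  - exact: dyadic_full.
  - exact: ltW.
  - by apply: nu_small => //; exact: measurableI.
have l20 : (0 < l / 2)%R by rewrite divr_gt0.
have {}IH e : exists F, [/\ measurable F, F `<=` hcube (child c l e) (l / 2)%R,
    dyadic n (child c l e) (l / 2)%R F,
    al%:E * mu F <= mu (E `&` hcube (child c l e) (l / 2)%R) &
    nu (E `&` hcube (child c l e) (l / 2)%R) <= be%:E * nu F].
  apply: IH => //.
  (* A child has [2 ^+ d] times less measure than its parent, so density at most [al] in the parent
     gives density at most [2 ^+ d * al] in the child. *)
  apply: (@le_trans _ _ (mu (E `&` hcube c l))).
    apply: le_measure; rewrite ?inE; last exact: setIS (sub_child l0).
      by apply: measurableI => //; exact: measurable_hcube.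
    exact: measurableI.
  rewrite (le_trans Esmall)//= !lebesgue_hcube// -!EFinM lee_fin mulrAC.
  by rewrite -exprMn mulrCA divff// mulr1 mulrC.
have {IH}[G /all_and2[mG /all_and2[GH /all_and2[DG /all_and2[muG nuG]]]]] :
    exists G : {ffun 'I_d -> bool} -> set (Rd R d), forall e,
      measurable (G e) /\ G e `<=` hcube (child c l e) (l / 2)%R /\
      dyadic n (child c l e) (l / 2)%R (G e) /\
      al%:E * mu (G e) <= mu (E `&` hcube (child c l e) (l / 2)%R) /\
      nu (E `&` hcube (child c l e) (l / 2)%R) <= be%:E * nu (G e).
  suff /choice[G HG] : forall e, exists F, [/\ measurable F,
      F `<=` hcube (child c l e) (l / 2)%R,
      dyadic n (child c l e) (l / 2)%R F,
      al%:E * mu F <= mu (E `&` hcube (child c l e) (l / 2)%R) &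
      nu (E `&` hcube (child c l e) (l / 2)%R) <= be%:E * nu F].
    by exists G => e; have [] := HG e.
  exact: IH.
have mUG : measurable (\bigcup_e G e).
  by apply: fin_bigcup_measurable => //; exact: finite_finset.
have UGe e : (\bigcup_e G e) `&` hcube (child c l e) (l / 2)%R = G e.
  apply/seteqP; split => [x [[e' _ Ge'x] Hex]|x Gx]; last first.
    by split; [exists e|exact: GH].
  suff <- : e' = e by [].
  by apply: (@trivIset_child R d c l setT l0) => //; exists x; split => //; exact: GH.
have UGH : (\bigcup_e G e) `<=` hcube c l.
  by move=> x [e _ /GH /(sub_child l0)].
exists (\bigcup_e G e); split => //.
- move=> e; apply: dyadic_eq (DG e) => //.
  by rewrite UGe; apply/setIidPl; exact: GH.
- rewrite -[X in mu X](setIidl UGH) !measure_children// ge0_mule_fsumr//.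
  by apply: lee_fsum => [|e _]; [exact: finite_finset|rewrite UGe].
- rewrite -[X in _ * nu X](setIidl UGH) !measure_children// ge0_mule_fsumr//.
  by apply: lee_fsum => [|e _]; [exact: finite_finset|rewrite UGe].
Qed.

(** Passing from [E] to the union [F] of its stopping cubes multiplies the density by at most
    [al^-1] and gains a factor [be] for [nu]. Since [F] is again dyadic, the step can be repeated
    [k] times. *)
Lemma dyadic_decay k n c l E : (0 < l)%R -> measurable E -> dyadic n c l E ->
  mu (E `&` hcube c l) <= (al ^+ k)%:E * mu (hcube c l) ->
  nu (E `&` hcube c l) <= (be ^+ k)%:E * nu (hcube c l).
Proof.
elim: k E => [|k IH] E l0 mE DE muE.
  rewrite expr0 mul1e; apply: le_measure; rewrite ?inE; last exact: subIsetr.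
    by apply: measurableI => //; exact: measurable_hcube.
  exact: measurable_hcube.
have al_le1 : (al <= 1)%R.
  apply: le_trans (ltW al1); rewrite ler_peMl//; first exact: ltW.
  by rewrite exprn_ege1// ler1n.
(* The stopping argument applies because [al ^+ k.+1 <= al <= 2 ^+ d * al]. *)
have [|F [mF FH DF muF nuF]] := stopping_cubes l0 mE DE.
  apply: le_trans muE _; rewrite lebesgue_hcube// -!EFinM lee_fin.
  rewrite ler_wpM2r ?exprn_ge0 ?(ltW l0)//.
  apply: (@le_trans _ _ al).
    by rewrite exprS ler_piMr ?(ltW al0)// exprn_ile1// ltW.
  by rewrite ler_peMl ?(ltW al0)// exprn_ege1// ler1n.
rewrite (le_trans nuF)// exprS EFinM -muleA lee_wpmul2l ?lee_fin//.
rewrite -[X in nu X](setIidl FH); apply: IH => //.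
rewrite (setIidl FH) -(@lee_pmul2l _ al%:E) ?lte_fin//.
by rewrite (le_trans muF)// muleA -EFinM -exprS.
Qed.

End dyadic.

(** * Approximation by dyadic sets *)

Section dyadic_approx.
Context (R : realType) (d : nat).
Local Notation mu := (lebesgue_Rd R d).
Implicit Types (c : d.-tuple R) (l : R) (E F : set (Rd R d)) (n : nat).

(** A hyperplane through a grid point of generation [n] cuts no subcube of that generation. Seen
    from an upper child, the grid index [z] drops by [2 ^+ n]. *)
Lemma dyadic_halfspace n c l (i : 'I_d) (z : int) : (0 < l)%R ->
  dyadic n c l [set x : d.-tuple R | (tnth x i <= tnth c i + l * z%:~R / 2 ^+ n)%R].
Proof.
elim: n c l z => [|n IH] c l z l0 /=.
  (* The cube is open at its lower faces, so [z = 0] already gives an empty trace. *)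
  rewrite expr0 divr1; case: (ltP 0%Z z) => z0; [left|right].
    move=> x /(_ i) /andP[_ /le_trans]; apply.
    by rewrite lerD2l ler_pMr// ler1z.
  apply/seteqP; split => // x [/= xi /(_ i) /andP[/lt_le_trans/(_ xi)]].
  by rewrite ltrDl pmulr_rgt0// ltr0z ltNge z0.
move=> e.
have := IH (child c l e) (l / 2)%R (z - (if e i then 2 ^+ n else 0))%R.
rewrite divr_gt0// => /(_ isT); rewrite tnth_mktuple.
congr (dyadic _ _ _ _); apply/seteqP; split => x /=; congr (_ <= _)%R.
all: case: (e i); rewrite ?subr0 ?addr0 ?intrB ?rmorphXn/= exprS; field.
all: by rewrite ?expf_neq0.
Qed.

Variables (m : {measure set (Rd R d) -> \bar R}) (c : d.-tuple R) (l : R).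
Hypothesis l0 : (0 < l)%R.
Local Notation H := (hcube c l).
Hypothesis mHoo : m H < +oo.

(** The closure of the dyadic sets for the pseudo-distance [m (H]&[(E]+[U))]. It is shown to be a
    sigma-algebra, so Borel sets enter through generators alone, without differentiation of
    integrals. *)
Definition dyadic_approx : set (set (Rd R d)) :=
  [set E | measurable E /\ forall e : R, (0 < e)%R -> exists n U,
    [/\ measurable U, dyadic n c l U & m (H `&` (E `+` U)) <= e%:E]].

Let mHI E : measurable E -> measurable (H `&` E).
Proof. by move=> mE; apply: measurableI => //; exact: measurable_hcube. Qed.

Let msetY E F : measurable E -> measurable F -> measurable (E `+` F).
Proof. by move=> mE mF; apply: measurableU; exact: measurableD. Qed.

Lemma dyadic_approxC E : dyadic_approx E -> dyadic_approx (~` E).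
Proof.
move=> [mE aE]; split => [|e e0]; first exact: measurableC.
have [n [U [mU DU EU]]] := aE e e0.
exists n, (~` U); split; [exact: measurableC|exact: dyadicC|].
rewrite (_ : ~` E `+` ~` U = E `+` U)// /setY !setDE !setCK setUC.
by rewrite [~` U `&` _]setIC [~` E `&` _]setIC.
Qed.

Lemma dyadic_approxU E F :
  dyadic_approx E -> dyadic_approx F -> dyadic_approx (E `|` F).
Proof.
move=> [mE aE] [mF aF]; split => [|e e0]; first exact: measurableU.
have e20 : (0 < e / 2)%R by rewrite divr_gt0.
have [n1 [U [mU DU EU]]] := aE _ e20.
have [n2 [V [mV DV FV]]] := aF _ e20.
exists (maxn n1 n2), (U `|` V); split; first exact: measurableU.
  by apply: dyadicU; [apply: dyadic_le DU|apply: dyadic_le DV];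
    rewrite ?leq_maxl ?leq_maxr.
apply: (@le_trans _ _ (m ((H `&` (E `+` U)) `|` (H `&` (F `+` V))))).
  apply: le_measure; rewrite ?inE.
  - by apply: mHI; apply: msetY; exact: measurableU.
  - by apply: measurableU; apply: mHI; exact: msetY.
  - move=> x [Hx]; rewrite /setY /= => xEF; rewrite -/(H x); tauto.
apply: le_trans (measureU2 _ _ _) _; try by apply: mHI; exact: msetY.
by rewrite [e]splitr EFinD; exact: leeD.
Qed.

Lemma dyadic_approx0 : dyadic_approx set0.
Proof.
split => // e e0; exists 0%N, set0; split => //; first by right; rewrite set0I.
by rewrite setYK setI0 measure0 lee_fin ltW.
Qed.

(** The tails of the union decrease to the empty set and [m] is finite on the cube, so a finite
    subunion is within [e / 2] of the whole; the other [e / 2] pays for approximating that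
    subunion. *)
Lemma dyadic_approx_bigcup (F : (set (Rd R d))^nat) :
  (forall n, dyadic_approx (F n)) -> dyadic_approx (\bigcup_n F n).
Proof.
move=> aF; have mF n : measurable (F n) by have [] := aF n.
have mUF : measurable (\bigcup_n F n) by exact: bigcupT_measurable.
split => // e e0; have e20 : (0 < e / 2)%R by rewrite divr_gt0.
pose G k := \big[setU/set0]_(i < k) F i.
have aG k : dyadic_approx (G k).
  rewrite /G; elim: k => [|k IH]; first by rewrite big_ord0; exact: dyadic_approx0.
  by rewrite big_ord_recr; exact: dyadic_approxU.
have mG k : measurable (G k) by have [] := aG k.
pose D k := H `&` ((\bigcup_n F n) `\` G k).
have mD k : measurable (D k) by apply: mHI; exact: measurableD.
have D0 : \bigcap_k D k = set0.
  apply/seteqP; split => // x Dx; have [_ [[n _ Fnx] _]] := Dx 0%N I.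
  have [_ [_]] := Dx n.+1 I; apply; rewrite /G big_ord_recr; right; exact: Fnx.
have : m (D k) @[k --> \oo] --> 0.
  rewrite -(measure0 m) -D0; apply: nonincreasing_cvg_mu => //.
  - apply: le_lt_trans mHoo; apply: le_measure; rewrite ?inE//.
    + exact: measurable_hcube.
    + exact: subIsetl.
  - by rewrite D0.
  - move=> j k jk; apply/subsetPset; apply: setIS; apply: setDS.
    by apply: subset_bigsetU.
move=> /fine_cvgP[_] /cvgrPdist_le /(_ _ e20) [k _ Dk].
have {}Dk : m (D k) <= (e / 2)%:E.
  have := Dk k (leqnn k); rewrite /= sub0r normrN ger0_norm ?fine_ge0//.
  rewrite -lee_fin fineK// ge0_fin_numE// (le_lt_trans _ mHoo)//.
  by apply: le_measure; rewrite ?inE//; [exact: measurable_hcube|exact: subIsetl].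
have [n [U [mU DU GU]]] := (aG k).2 _ e20.
exists n, U; split => //.
apply: (@le_trans _ _ (m (D k `|` (H `&` (G k `+` U))))).
  apply: le_measure; rewrite ?inE.
  - by apply: mHI; exact: msetY.
  - by apply: measurableU => //; apply: mHI; exact: msetY.
  - have GF x : G k x -> (\bigcup_n F n) x.
      by rewrite /G -bigcup_mkord => -[j _ Fj]; exists j.
    move=> x [Hx]; rewrite /D /setY /= => xFU; have := GF x.
    have [] := pselect (G k x); tauto.
apply: le_trans (measureU2 _ _ _) _ => //; first by apply: mHI; exact: msetY.
by rewrite [e]splitr EFinD; exact: leeD.
Qed.

(** Rays generate the Borel sets of the line, and the half-space of a ray is a countable
    intersection of half-spaces bounded by grid points, which are dyadic. *)
Lemma dyadic_approx_preimage (i : 'I_d) (B : set (measurableTypeR R)) :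
  measurable B ->
  dyadic_approx ((fun x : d.-tuple R => tnth x i : measurableTypeR R) @^-1` B).
Proof.
set f := fun _ => _.
have ray (a : R) : dyadic_approx (f @^-1` `]-oo, a]%classic).
  have aI (F : (set (Rd R d))^nat) :
      (forall n, dyadic_approx (F n)) -> dyadic_approx (\bigcap_n F n).
    move=> aF; rewrite -[X in dyadic_approx X]setCK setC_bigcap.
    apply: dyadic_approxC; apply: dyadic_approx_bigcup => n.
    exact: dyadic_approxC.
  (* [v n] is the first point strictly above [a] in the grid of mesh [l / 2 ^+ n] based at
     [tnth c i]. *)
  pose y n := (2 ^+ n * (a - tnth c i) / l)%R.
  pose v n := (tnth c i + l * (Num.floor (y n) + 1)%:~R / 2 ^+ n)%R.
  have av n : (a < v n <= a + l / 2 ^+ n)%R.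
    have /andP[y1 y2] := real_floor_itv (num_real (y n)).
    have p2 : (0 < 2 ^+ n :> R)%R by rewrite exprn_gt0.
    have ayE : (a = tnth c i + l * y n / 2 ^+ n)%R.
      by rewrite /y; field; rewrite gt_eqF// gt_eqF.
    rewrite /v {1 2}ayE ltrD2l ltr_pM2r ?invr_gt0// ltr_pM2l// y2/=.
    rewrite -addrA lerD2l -mulrDl ler_pM2r ?invr_gt0//.
    by rewrite intrD mulrDr mulr1 lerD2r ler_pM2l.
  rewrite (_ : _ @^-1` _ = \bigcap_n [set x : d.-tuple R | (tnth x i <= v n)%R]).
    apply: aI => n.
    have mS : measurable ([set x : d.-tuple R | (tnth x i <= v n)%R] : set (Rd R d)).
      apply: borel_measurable_Rd.
      rewrite (_ : [set _ | _] =
          (fun x : d.-tuple (measurableTypeR R) => tnth x i) @^-1` `]-oo, v n]%classic).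
        rewrite -[X in measurable X]setTI.
        apply: measurable_tnth => //; exact: measurable_itv.
      by apply/seteqP; split => x /=; rewrite in_itv.
    split => // e e0.
    exists n, [set x : d.-tuple R | (tnth x i <= v n)%R]; split => //.
    - exact: dyadic_halfspace.
    - by rewrite setYK setI0 measure0 lee_fin ltW.
  apply/seteqP; split => x /=; rewrite in_itv/=.
    by move=> xa n _ /=; have /andP[/ltW + _] := av n; exact: le_trans.
  (* A point with coordinate above [a] is excluded by any grid of mesh smaller than its excess over
     [a]. *)
  move=> xv; rewrite leNgt; apply/negP => ax.
  have : (0 <= l / (f x - a))%R by rewrite divr_ge0 ?subr_ge0 ?ltW.
  move=> /archi_boundP; set N := Num.bound _ => lN.
  have : (l / (f x - a) < 2 ^+ N)%R.
    by rewrite (lt_trans lN)// -natrX ltr_nat ltn_expl.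
  rewrite ltr_pdivrMr ?subr_gt0// mulrC -ltr_pdivrMr ?exprn_gt0// ltrBrDl.
  move=> h; have /andP[_ vl] := av N.
  by have := le_lt_trans (le_trans (xv N I) vl) h; rewrite ltxx.
move=> mB; suff : measurable `<=` [set B | dyadic_approx (f @^-1` B)] by exact.
apply: smallest_sub; first split.
- by rewrite /= preimage_set0; exact: dyadic_approx0.
- by move=> A /= aA; rewrite setTD preimage_setC; exact: dyadic_approxC.
- by move=> A aA /=; rewrite preimage_bigcup; exact: dyadic_approx_bigcup.
(* The generators are half-open intervals, which are obtained from two rays by complement and
   union. *)
move=> _ [[x y] _ <-] /=.
have -> : `]x, y]%classic = ~` (`]-oo, x]%classic `|` ~` `]-oo, y]%classic).
  apply/seteqP; split => z /=; rewrite !in_itv/=.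
    by move=> /andP[xz zy] [|//]; rewrite leNgt xz.
  by move/not_orP => [/negP zx /contrapT zy]; rewrite ltNge zx zy.
rewrite -preimage_setC preimage_setU -preimage_setC.
by apply: dyadic_approxC; apply: dyadic_approxU => //; exact: dyadic_approxC.
Qed.

Lemma dyadic_approx_borel (E : set (d.-tuple (measurableTypeR R))) :
  measurable E -> dyadic_approx E.
Proof.
move=> mE; suff : @measurable _ (d.-tuple (measurableTypeR R)) `<=` dyadic_approx.
  exact.
apply: smallest_sub; first split.
- exact: dyadic_approx0.
- by move=> A aA; rewrite setTD; exact: dyadic_approxC.
- exact: dyadic_approx_bigcup.
rewrite -bigcup_seq => _ [i _ [B mB <-]]; rewrite setTI.
exact: dyadic_approx_preimage.
Qed.

Hypothesis m_mu : forall N, measurable N -> mu N = 0 -> m N = 0.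

(** A Lebesgue measurable set lies in a Borel set with the same measure; the difference is null for
    [mu], hence for [m], and the Borel case applies. *)
Lemma dyadic_approx_measurable E : measurable E -> E `<=` H -> dyadic_approx E.
Proof.
move=> mE EH; have mH := @measurable_hcube R d c l.
have muEoo : mu E < +oo.
  apply: (@le_lt_trans _ _ (mu H)); last by rewrite lebesgue_hcube// ltry.
  by apply: le_measure; rewrite ?inE.
have muEfin : mu E \is a fin_num by rewrite ge0_fin_numE.
have HB (k : nat) : exists B : set (d.-tuple (measurableTypeR R)),
    [/\ measurable B, E `<=` B & mu B <= mu E + (k.+1%:R^-1)%:E].
  have k0 : (0 < k.+1%:R^-1 :> R)%R by rewrite invr_gt0.
  (* [mu E] is by construction an infimum over countable Borel covers; the union of a nearly optimal
     cover is the required Borel set. *)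
  have [_ [F [mF EF] <-] Flt] := lb_ereal_inf_adherent k0 muEfin.
  exists (\bigcup_n F n); split => //; first exact: bigcupT_measurable.
  rewrite lebesgue_RdE; last exact: bigcupT_measurable.
  apply: le_trans (ltW Flt).
  by apply: measure_sigma_subadditive => //; exact: bigcupT_measurable.
have {HB}[F /all_and3[mF EF muF]] := choice HB.
pose B := \bigcap_k F k.
have mB : measurable B by exact: bigcapT_measurable.
have mB' : measurable (B : set (Rd R d)) by exact: borel_measurable_Rd.
have EB : E `<=` B by move=> x Ex k _; exact: EF.
have muB : mu B <= mu E.
  apply/lee_addgt0Pr => e e0.
  have := archi_boundP (ltW (divr_gt0 ltr01 e0)); set N := Num.bound _ => eN.
  apply: (@le_trans _ _ (mu (F N))).
    by apply: le_measure; rewrite ?inE//; [exact: borel_measurable_Rd|exact: bigcap_inf].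
  apply: le_trans (muF N) _; rewrite leeD2l// lee_fin.
  rewrite -[leRHS]invrK lef_pV2 ?posrE ?invr_gt0//.
  by rewrite -div1r (le_trans (ltW eN))// ler_nat.
have muBE : mu (B `\` E) = 0.
  rewrite measureD//; last by rewrite (le_lt_trans muB).
  rewrite (setIidr EB) [X in X - _](_ : _ = mu E) ?subee//.
  by apply/eqP; rewrite eq_le muB le_measure ?inE.
split => // e e0.
have [n [U [mU DU BU]]] := (dyadic_approx_borel mB).2 _ e0.
exists n, U; split => //.
apply: (@le_trans _ _ (m ((H `&` (B `+` U)) `|` (B `\` E)))).
  apply: le_measure; rewrite ?inE.
  - by apply: mHI; exact: msetY.
  - by apply: measurableU; [apply: mHI; exact: msetY|exact: measurableD].
  - move=> x [Hx]; rewrite /setY /= => xEU; have := EB x.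
    have [] := pselect (B x); have [] := pselect (E x); tauto.
apply: le_trans (measureU2 _ _ _) _ => //.
- by apply: mHI; exact: msetY.
- exact: measurableD.
- rewrite -[leRHS]adde0; apply: leeD => //.
  by rewrite [leLHS]m_mu//; exact: measurableD.
Qed.

End dyadic_approx.

(** * Power decay of densities *)

Section decay.
Context (R : realType) (d : nat).
Local Notation mu := (lebesgue_Rd R d).
Implicit Types (c : d.-tuple R) (l : R) (E : set (Rd R d)).
Variables (nu : {measure set (Rd R d) -> \bar R}) (al be : R).
Hypotheses (al0 : (0 < al)%R) (al1 : (2 ^+ d * al < 1)%R).
Hypotheses (be0 : (0 < be)%R) (be1 : (be < 1)%R).
Hypothesis nu_small : forall c l E, (0 < l)%R -> measurable E ->
  E `<=` hcube c l -> mu E <= (2 ^+ d * al)%:E * mu (hcube c l) ->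
  nu E <= be%:E * nu (hcube c l).
Hypothesis nu_fin : forall c l, (0 < l)%R -> nu (hcube c l) < +oo.
Hypothesis nu_mu : forall N, measurable N -> mu N = 0 -> nu N = 0.

Lemma measurable_decay k c l E : (0 < l)%R -> measurable E -> E `<=` hcube c l ->
  mu E < (al ^+ k)%:E * mu (hcube c l) ->
  nu E <= (be ^+ k)%:E * nu (hcube c l).
Proof.
move=> l0 mE EH muE; have mH := @measurable_hcube R d c l.
(* Approximating [E] for [mu + nu] controls both measures at once. *)
pose m := measure_add mu nu.
have mHoo : m (hcube c l) < +oo.
  by rewrite /m measure_addE lte_add_pinfty ?nu_fin// [ltLHS]lebesgue_hcube// ltry.
have m0 N : measurable N -> mu N = 0 -> m N = 0.
  by move=> mN muN; rewrite /m measure_addE muN nu_mu// adde0.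
have aE := dyadic_approx_measurable l0 mHoo m0 mE EH.
have muEfin : mu E \is a fin_num.
  by rewrite ge0_fin_numE// (lt_trans muE)// lebesgue_hcube// -EFinM ltry.
(* The strict bound on [mu E] leaves a gap; an approximation error below it keeps the dyadic set [U]
   within the bound required by [dyadic_decay]. *)
have : (0 < al ^+ k * l ^+ d - fine (mu E))%R.
  by rewrite subr_gt0 -lte_fin fineK// EFinM -(lebesgue_hcube c l0).
set gap := (_ - _)%R => gap0.
apply/lee_addgt0Pr => e e0.
have eg0 : (0 < Num.min e gap)%R by rewrite lt_min e0.
have [n [U [mU DU EU]]] := aE.2 _ eg0.
have mD : measurable (hcube c l `&` (E `+` U)).
  by apply: measurableI => //; apply: measurableU; exact: measurableD.
have [muEU nuEU] : mu (hcube c l `&` (E `+` U)) <= (Num.min e gap)%:E /\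
    nu (hcube c l `&` (E `+` U)) <= (Num.min e gap)%:E.
  have {}EU : mu (hcube c l `&` (E `+` U)) + nu (hcube c l `&` (E `+` U)) <=
      (Num.min e gap)%:E by rewrite -measure_addE.
  by split; apply: le_trans EU; rewrite ?leeDl// leeDr.
have muU : mu (U `&` hcube c l) <= (al ^+ k)%:E * mu (hcube c l).
  apply: (@le_trans _ _ (mu (E `|` (hcube c l `&` (E `+` U))))).
    apply: le_measure; rewrite ?inE.
    - exact: measurableI.
    - exact: measurableU.
    - move=> x [Ux Hx]; rewrite /setY/=; have [] := pselect (E x); tauto.
  apply: le_trans (measureU2 _ _ _) _ => //.
  rewrite lebesgue_hcube// -EFinM.
  apply: (@le_trans _ _ (mu E + gap%:E)).
    by rewrite leeD2l// (le_trans muEU)// lee_fin ge_min lexx orbT.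
  by rewrite -(fineK muEfin) -EFinD lee_fin /gap addrC subrK.
have nuU := dyadic_decay al0 al1 (ltW be0) nu_small l0 mU DU muU.
apply: (@le_trans _ _ (nu ((U `&` hcube c l) `|` (hcube c l `&` (E `+` U))))).
  apply: le_measure; rewrite ?inE//.
  - by apply: measurableU => //; exact: measurableI.
  - move=> x Ex; have Hx := EH _ Ex; rewrite /setY/=; have [] := pselect (U x); tauto.
apply: le_trans (measureU2 _ _ _) _ => //; first exact: measurableI.
by apply: leeD => //; rewrite (le_trans nuEU)// lee_fin ge_min lexx.
Qed.

Lemma power_decay c l E : (0 < l)%R -> measurable E -> E `<=` hcube c l ->
  nu E <= (be^-1 * (fine (mu E) / l ^+ d) `^ (ln be / ln al))%:E * nu (hcube c l).
Proof.
move=> l0 mE EH.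
have muH := @lebesgue_hcube R d c l l0.
have ld0 : (0 < l ^+ d)%R by rewrite exprn_gt0.
have mH := @measurable_hcube R d c l.
have muEH : mu E <= (l ^+ d)%:E by rewrite -muH; apply: le_measure; rewrite ?inE.
have muEfin : mu E \is a fin_num by rewrite ge0_fin_numE// (le_lt_trans muEH)// ltry.
have al_lt1 : (al < 1)%R.
  apply: le_lt_trans al1; rewrite ler_peMl//; first exact: ltW.
  by rewrite exprn_ege1// ler1n.
set e := (fine (mu E) / l ^+ d)%R.
have : (0 <= e)%R by rewrite divr_ge0// ?fine_ge0// ltW.
rewrite le_eqVlt => /predU1P[e0|e0].
  rewrite nu_mu//; first by rewrite mule_ge0// lee_fin mulr_ge0 ?invr_ge0 ?powR_ge0// ltW.
  move/esym/eqP : e0; rewrite mulf_eq0 invr_eq0 (gt_eqF ld0) orbF => /eqP muE0.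
  by rewrite -(fineK muEfin) muE0.
have e1 : (e <= 1)%R by rewrite ler_pdivrMr// mul1r -lee_fin fineK.
have lnal : (ln al < 0)%R by rewrite ln_lt0// al0.
have alde : (al `^ (ln be / ln al) = be)%R.
  rewrite /powR gt_eqF// -mulrA mulVf ?lt_eqF// mulr1 lnK//.
have dl0 : (0 <= ln be / ln al)%R.
  by rewrite -mulrNN mulr_ge0// ?oppr_ge0 ?invr_le0 ?(ltW lnal)// ltW// ln_lt0// be0.
have ex : exists k, (al ^+ k <= e)%R.
  have al_lt : (`|al| < 1)%R by rewrite gtr0_norm.
  have /cvgrPdist_le /(_ _ e0)[k _ ek] := cvg_geometric 1 al_lt.
  exists k; have := ek k (leqnn k).
  by rewrite sub0r normrN /geometric/= mul1r ger0_norm// exprn_ge0// ltW.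
(* The least exponent is 0 only when [e = 1]; otherwise it is [k.+1], and minimality gives the
   strict bound [e < al ^+ k]. *)
have [] := ex_minnP ex; case=> [|k] ke kmin.
  have {ke} -> : e = 1%R by apply/eqP; rewrite eq_le e1; move: ke; rewrite expr0.
  rewrite powR1 mulr1; apply: (@le_trans _ _ (nu (hcube c l))).
    by apply: le_measure; rewrite ?inE.
  by rewrite -[leLHS]mul1e lee_wpmul2r// lee_fin invf_ge1// ltW.
apply: (@le_trans _ _ ((be ^+ k)%:E * nu (hcube c l))).
  apply: measurable_decay => //.
  rewrite muH -EFinM -(fineK muEfin) lte_fin -ltr_pdivrMr// -/e ltNge.
  by apply/negP => /kmin; rewrite ltnn.
rewrite lee_wpmul2r// lee_fin ler_pdivlMl// -exprS -[X in (X ^+ _)%R]alde.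
rewrite -powR_mulrn ?powR_ge0// powRAC powR_mulrn ?(ltW al0)//.
by apply: ge0_ler_powR; rewrite ?nnegrE ?exprn_ge0 // ltW.
Qed.

End decay.

(** * Weights satisfying a Muckenhoupt condition *)

Section integral_bounds.
Context d (T : measurableType d) (R : realType) (m : {measure set T -> \bar R}).

Lemma integral_gt0_pos (D : set T) (f : T -> R) : measurable D ->
  measurable_fun D f -> (forall x, D x -> (0 < f x)%R) -> 0 < m D ->
  0 < \int[m]_(x in D) (f x)%:E.
Proof.
move=> mD mf f0 mD0; rewrite lt_neqAle integral_ge0 ?andbT; last first.
  by move=> x Dx; rewrite lee_fin ltW// f0.
apply/eqP => /esym int0.
have : \int[m]_(x in D) `|(f x)%:E| = 0.
  rewrite -int0; apply: eq_integral => x; rewrite inE => Dx.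
  by rewrite gee0_abs// lee_fin ltW// f0.
move=> /(ae_eq_integral_abs m mD (f := EFin \o f)) => /(_ _)/wrap[].
  exact/measurable_EFinP.
move=> [N [mN N0 DN]]; suff : m D <= 0 by rewrite leNgt mD0.
rewrite -N0; apply: le_measure; rewrite ?inE// => x Dx; apply: DN => /=.
by move=> /(_ Dx) /= [fx0]; have := f0 x Dx; rewrite fx0 ltxx.
Qed.

Lemma cst_le_integral (D : set T) (f : T -> R) (k : R) : measurable D ->
  measurable_fun D f -> (0 <= k)%R -> (forall x, D x -> (k <= f x)%R) ->
  k%:E * m D <= \int[m]_(x in D) (f x)%:E.
Proof.
move=> mD mf k0 kf; rewrite -integral_cst//; apply: ge0_le_integral => //.
exact/measurable_EFinP.
Qed.

Lemma subset_integral_EFin (E F : set T) (f : T -> R) : measurable E ->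
  measurable F -> measurable_fun F f -> (forall x, (0 <= f x)%R) -> E `<=` F ->
  \int[m]_(x in E) (f x)%:E <= \int[m]_(x in F) (f x)%:E.
Proof.
move=> mE mF mf f0 EF; apply: ge0_subset_integral => //.
  exact/measurable_EFinP.
by move=> x _; rewrite lee_fin.
Qed.

End integral_bounds.

Section density.
Context d (T : measurableType d) (R : realType) (m : {measure set T -> \bar R}).
Variable f : T -> R.
Hypotheses (mf : measurable_fun [set: T] f) (f0 : forall x, (0 <= f x)%R).

(** The proofs are arguments so that the measure structure can be attached to [density mf f0]. *)
Definition density of measurable_fun [set: T] f & (forall x, (0 <= f x)%R) :
  set T -> \bar R := fun A => \int[m]_(x in A) (f x)%:E.

Let nu := density mf f0.

Let nu0 : nu set0 = 0.
Proof. exact: integral_set0. Qed.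

Let nu_ge0 A : 0 <= nu A.
Proof. by apply: integral_ge0 => x _; rewrite lee_fin. Qed.

Let nu_sigma : semi_sigma_additive nu.
Proof.
apply: semi_sigma_additive_nng_induced => [|x]; first exact/measurable_EFinP.
by rewrite lee_fin.
Qed.

HB.instance Definition _ := isMeasure.Build _ _ _ nu nu0 nu_ge0 nu_sigma.

End density.

(** For [a = q] and [b = p'] this is the [A_pq] condition with bound [K]. Replacing [v] by its
    inverse exchanges [a] and [b], so one argument serves both factors. *)
Definition muckenhoupt (R : realType) (d : nat) (v : Rd R d -> R) (a b K : R) :=
  forall c l, (0 < l)%R -> let Q := ccube c l in
  ((lebesgue_Rd R d Q)^-1 *
    \int[lebesgue_Rd R d]_(x in Q) (v x `^ a)%:E) `^ a^-1 *
  ((lebesgue_Rd R d Q)^-1 *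
    \int[lebesgue_Rd R d]_(x in Q) (v x `^ (- b))%:E) `^ b^-1 <= K%:E.

(** * The A_infinity property and the decay of rearrangements of weights *)

Section ainf.
Context (R : realType) (d : nat).
Local Notation mu := (lebesgue_Rd R d).
Variables (v : Rd R d -> R) (a b K : R).
Hypotheses (mv : measurable_fun [set: Rd R d] v) (v0 : forall x, (0 < v x)%R).
Hypotheses (a0 : (0 < a)%R) (b0 : (0 < b)%R) (K0 : (0 < K)%R).
Hypothesis HK : muckenhoupt v a b K.

Let mvp p : measurable_fun [set: Rd R d] (fun x => (v x `^ p)%R).
Proof. exact: (measurableT_comp (measurable_powR _)). Qed.

Let vp0 p x : (0 < v x `^ p)%R.
Proof. exact: powR_gt0. Qed.

Let vp0' p x : (0 <= v x `^ p)%R.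
Proof. exact: powR_ge0. Qed.

Local Notation I E := (\int[mu]_(x in E) (v x `^ a)%:E).
Local Notation J E := (\int[mu]_(x in E) (v x `^ (- b))%:E).

Lemma weight_integral_sub p (E F : set (Rd R d)) : measurable E -> measurable F ->
  E `<=` F ->
  \int[mu]_(x in E) (v x `^ p)%:E <= \int[mu]_(x in F) (v x `^ p)%:E.
Proof.
move=> mE mF EF.
exact: (subset_integral_EFin mu mE mF (measurable_funTS (mvp p)) (vp0' p) EF).
Qed.

(** Both integrals are positive, so a finite bound on the product forces both averages to be finite;
    solving it for [X] gives the last inequality. *)
Lemma weight_averages c l : (0 < l)%R -> exists X A : R,
  [/\ (0 < X)%R, (0 < A)%R, I (ccube c l) = (X * l ^+ d)%:E,
    J (ccube c l) = (A * l ^+ d)%:E & (X <= K `^ a * A `^ (- (a / b)))%R].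
Proof.
move=> l0; have L0 : (0 < l ^+ d)%R by rewrite exprn_gt0.
have muQ := lebesgue_ccube c l0.
have mQ := measurable_ccube c l.
have gt0 p : 0 < \int[mu]_(x in ccube c l) (v x `^ p)%:E.
  apply: (integral_gt0_pos mQ (measurable_funTS (mvp p))) => //.
  by rewrite muQ lte_fin.
have := HK c l0; rewrite /= muQ inver gt_eqF//.
have := gt0 a; have := gt0 (- b)%R.
case: (I _) => [I'| |]; case: (J _) => [J'| |] //.
- rewrite !lte_fin => J0 I0; rewrite -!EFinM lee_fin => IJ.
  have X0 : (0 < (l ^+ d)^-1 * I')%R by rewrite mulr_gt0// invr_gt0.
  have A0 : (0 < (l ^+ d)^-1 * J')%R by rewrite mulr_gt0// invr_gt0.
  exists ((l ^+ d)^-1 * I')%R, ((l ^+ d)^-1 * J')%R; split => //.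
  + by congr EFin; field; rewrite gt_eqF.
  + by congr EFin; field; rewrite gt_eqF.
  + rewrite -ler_pdivlMr ?powR_gt0// in IJ.
    have := ge0_ler_powR (ltW a0) _ _ IJ.
    rewrite !nnegrE powR_ge0 => /(_ isT).
    rewrite divr_ge0 ?powR_ge0 ?(ltW K0)// => /(_ isT).
    rewrite -powRrM mulVf ?gt_eqF// powRr1 ?(ltW X0)// => /le_trans; apply.
    rewrite powRM ?invr_ge0 ?powR_ge0 ?(ltW K0)// ler_pM2l ?powR_gt0//.
    rewrite -[((_ `^ b^-1)^-1)%R]powR_inv1 ?powR_ge0// -!powRrM le_eqVlt; apply/orP; left.
    by apply/eqP; congr powR; field; rewrite gt_eqF.
(* If one integral is infinite, its positive partner makes the product infinite, against the bound
   [K]. *)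
all: move=> J0 I0; have c0 : 0 < ((l ^+ d)^-1)%:E by rewrite lte_fin invr_gt0.
- have ? : 0 < ((l ^+ d)^-1)%:E * I'%:E by rewrite mule_gt0.
  rewrite (gt0_muley c0) [X in _ * X]poweRyr ?gt_eqF ?invr_gt0//.
  by rewrite gt0_muley// poweR_gt0.
- have ? : 0 < ((l ^+ d)^-1)%:E * J'%:E by rewrite mule_gt0.
  rewrite (gt0_muley c0) [X in X * _]poweRyr ?gt_eqF ?invr_gt0//.
  by rewrite gt0_mulye// poweR_gt0.
- rewrite (gt0_muley c0) [X in X * _]poweRyr ?gt_eqF ?invr_gt0//.
  by rewrite [X in _ * X]poweRyr ?gt_eqF ?invr_gt0.
Qed.

(** This makes [2 ^+ d * al = 1 / 4], which leaves room beside a Chebyshev set of density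
    [1 / 2]. *)
Let al : R := (2 ^+ d.+2)^-1%R.
Let eta : R := (2 `^ (- (a / b)) / (4 * K `^ a))%R.
(* The maximum with [3 / 4] keeps [al < be], so that the exponent
   [ln be / ln al] of [power_decay] is less than 1. *)
Let be : R := Num.max (3 / 4)%R (1 - eta)%R.

(** Removing [E] and the set [B] where [v]^ (-
    b)[exceeds twice its average leaves a set]F[of density at least]1 / 4[. There]v [^ a] is bounded
    below, so [F] takes a fixed share of the integral away from [E]. *)
Lemma weight_nu_small c l E : (0 < l)%R -> measurable E -> E `<=` hcube c l ->
  mu E <= (2 ^+ d * al)%:E * mu (hcube c l) ->
  I E <= be%:E * I (hcube c l).
Proof.
move=> l0 mE EH; rewrite lebesgue_hcube// -EFinM.
have -> : (2 ^+ d * al * l ^+ d = l ^+ d / 4)%R.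
  by rewrite /al !exprS; field; rewrite ?expf_neq0.
move=> muE.
have [X [A [X0 A0 IX JA XA]]] := weight_averages c l0.
have mH := measurable_hcube c l.
have mQ := measurable_ccube c l.
have HQ := @sub_hcube_ccube R d c l.
pose B := hcube c l `&` [set x | (2 * A < v x `^ (- b))%R].
have mB : measurable B.
  rewrite /B (_ : [set _ | _] = (fun x => v x `^ (- b))%R @^-1` `](2 * A)%R, +oo[%classic).
    rewrite -[X in measurable (_ `&` X)]setTI; apply: measurableI => //.
    by apply: mvp => //; exact: measurable_itv.
  by apply/seteqP; split => x /=; rewrite in_itv/= andbT.
have L0 : (0 < l ^+ d)%R by rewrite exprn_gt0.
have muB : mu B <= (l ^+ d / 2)%:E.
  have : (2 * A)%:E * mu B <= J (ccube c l).
    apply: (@le_trans _ _ (J B)).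
      apply: (cst_le_integral mu mB (measurable_funTS (mvp _))).
        by rewrite mulr_ge0// ltW.
      by move=> x [_ /ltW].
    by apply: (weight_integral_sub _ mB mQ) => x [Hx _]; exact: HQ.
  rewrite JA -lee_pdivlMl ?mulr_gt0// -EFinM => /le_trans; apply.
  by rewrite lee_fin le_eqVlt; apply/orP; left; apply/eqP; field; rewrite gt_eqF.
pose F := hcube c l `\` (E `|` B).
have mF : measurable F by apply: measurableD => //; exact: measurableU.
(* The density left is at least [1 - 1 / 4 - 1 / 2]. *)
have muF : (l ^+ d / 4)%:E <= mu F.
  have : mu (hcube c l) <= mu E + mu B + mu F.
    apply: (@le_trans _ _ (mu ((E `|` B) `|` F))).
      apply: le_measure; rewrite ?inE//.
        by apply: measurableU => //; exact: measurableU.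
      by move=> x Hx; have [] := pselect ((E `|` B) x); [left|right].
    apply: le_trans (measureU2 _ _ _) _ => //; first exact: measurableU.
    by rewrite leeD2r//; exact: measureU2.
  rewrite lebesgue_hcube// => H3.
  have : (l ^+ d)%:E <= (l ^+ d / 4)%:E + (l ^+ d / 2)%:E + mu F.
    by apply: le_trans H3 _; rewrite leeD2r// leeD.
  case: (mu F) => [x| |//]; last by move=> _; rewrite leey.
  by rewrite -!EFinD !lee_fin; lra.
have IF : (eta * (X * l ^+ d))%:E <= I F.
  apply: (@le_trans _ _ (((2 * A) `^ (- (a / b)))%R%:E * mu F)).
    apply: (@le_trans _ _ ((2 * A) `^ (- (a / b)) * (l ^+ d / 4))%R%:E); last first.
      by rewrite EFinM lee_wpmul2l// lee_fin powR_ge0.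
    rewrite lee_fin powRM// ?(ltW A0)// /eta.
    have k0 : (0 < K `^ a)%R by exact: powR_gt0.
    have p0 : (0 < 2 `^ (- (a / b)) :> R)%R by exact: powR_gt0.
    move: (K `^ a)%R (2 `^ _)%R (A `^ _)%R k0 p0 XA => k p y k0 p0 XA.
    rewrite (_ : (p / (4 * k) * (X * l ^+ d) = p * (X / k) * (l ^+ d / 4))%R); last first.
      by field; rewrite gt_eqF.
    by rewrite ler_pM2r ?divr_gt0// ler_pM2l// ler_pdivrMr// mulrC.
  apply: (cst_le_integral mu mF (measurable_funTS (mvp _))); first exact: powR_ge0.
  move=> x [Hx /not_orP [_ nB]].
  have vA : (v x `^ (- b) <= 2 * A)%R.
    by rewrite leNgt; apply/negP => vA; apply: nB.
  have -> : (v x `^ a = (v x `^ (- b)) `^ (- (a / b)))%R.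
    by rewrite -powRrM; congr powR; field; rewrite gt_eqF.
  exact: ler_powRN (ltW (divr_gt0 a0 b0)) (vp0 _ _) vA.
have IEF : I E + I F <= I (hcube c l).
  rewrite -(ge0_integral_setU _ mE mF).
  - apply: (weight_integral_sub _ (measurableU _ _ mE mF) mH).
    by move=> x [/EH//|[]].
  - exact/measurable_EFinP/measurable_funTS/mvp.
  - by move=> x _; rewrite lee_fin.
  - by apply/disj_setPS => x [Ex [_ /not_orP[]]].
have IHQ : I (hcube c l) <= (X * l ^+ d)%:E.
  by rewrite -IX; exact: (weight_integral_sub _ mH mQ HQ).
have eta0 : (0 <= eta)%R by rewrite divr_ge0 ?powR_ge0// mulr_ge0 ?powR_ge0.
have IH0 : 0 <= I (hcube c l) by apply: integral_ge0 => x _; rewrite lee_fin.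
have IE0 : 0 <= I E by apply: integral_ge0 => x _; rewrite lee_fin.
have IH1 := le_trans (leeD2l (I E) IF) IEF.
(* With [h] the integral over the half-open cube, [I E <= h - eta * (X * l ^+ d)] and
   [h <= X * l ^+ d] give [I E <= (1 - eta) * h]. *)
move: IHQ IH0 IE0 IH1; case: (I (hcube c l)) => [h| |]//.
case: (I E) => [x| |]//; rewrite -EFinM -EFinD !lee_fin => hX h0 x0 xh.
have : ((1 - eta) * h <= be * h)%R by rewrite ler_wpM2r// le_max lexx orbT.
apply: le_trans; rewrite mulrBl mul1r lerBrDr (le_trans _ xh)// lerD2l.
by rewrite ler_wpM2l.
Qed.

Lemma weight_power_decay : exists C k : R, [/\ (0 < C)%R, (0 < k < 1)%R &
  forall c l E, (0 < l)%R -> measurable E -> E `<=` hcube c l ->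
    I E <= (C * (fine (mu E) / l ^+ d) `^ (1 - k))%:E * I (hcube c l)].
Proof.
have al0 : (0 < al)%R by rewrite invr_gt0 exprn_gt0.
have al4 : (2 ^+ d * al = 4^-1)%R.
  by rewrite /al !exprS; field; rewrite ?expf_neq0.
have al_le4 : (al <= 4^-1)%R.
  rewrite -al4 ler_peMl ?(ltW al0)//.
  by rewrite exprn_ege1// ler1n.
have eta0 : (0 < eta)%R by rewrite divr_gt0 ?powR_gt0// mulr_gt0 ?powR_gt0.
have be0 : (0 < be)%R by rewrite lt_max divr_gt0.
have be1 : (be < 1)%R by rewrite gt_max; apply/andP; split; lra.
have albe : (al < be)%R by rewrite lt_max; apply/orP; left; lra.
have al1 : (al < 1)%R by lra.
have lnal : (ln al < 0)%R by rewrite ln_lt0// al0.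
have lnbe : (ln be < 0)%R by rewrite ln_lt0// be0.
(* [1 - k] is the exponent of [power_decay]; it lies strictly between 0 and 1 because
   [al < be < 1]. *)
exists be^-1%R, (1 - ln be / ln al)%R; split; first by rewrite invr_gt0.
  rewrite subr_gt0 gtrBl ltr_ndivrMr// mul1r ltr_ln ?posrE// albe/=.
  by rewrite -mulrNN mulr_gt0// ?oppr_gt0 ?invr_lt0.
move=> c l E l0 mE EH; rewrite opprB addrCA subrr addr0.
apply: (@power_decay _ _ (density mu (mvp a) (vp0' a)) al be) => //.
- by rewrite al4; lra.
- exact: weight_nu_small.
- move=> c' l' l'0; have [X [A [_ _ IX _ _]]] := weight_averages c' l'0.
  apply: (@le_lt_trans _ _ (I (ccube c' l'))); last by rewrite IX ltry.
  apply: (weight_integral_sub _ (measurable_hcube _ _) (measurable_ccube _ _)).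
  exact: sub_hcube_ccube.
- move=> N mN N0; apply: (null_set_integral mN _ N0).
  exact/measurable_EFinP/measurable_funTS/mvp.
Qed.

(** It suffices that the level set [E] at the proposed height [la] has measure at most [t].
    Chebyshev bounds [la]^ a * mu E[by the integral over]E[, and the power decay bounds that
    integral by a multiple of](mu E) [^ (1 - k)]; together they limit [mu E]. *)
Lemma rearr_weight_bound : exists C k : R, [/\ (0 < C)%R, (0 < k < 1)%R &
  forall c l t X, (0 < l)%R -> (0 < t)%R -> (0 < X)%R ->
    I (ccube c l) = (X * l ^+ d)%:E ->
    decr_rearr mu ((EFin \o v) \_ (ccube c l)) t <=
      (C * X `^ a^-1 * (t / l ^+ d) `^ (- (k / a)))%:E].
Proof.
have [C [k [C0 /andP[k0 k1] HC]]] := weight_power_decay.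
exists (C `^ a^-1)%R, k; split; [exact: powR_gt0|by rewrite k0|].
move=> c l t X l0 t0 X0 IX; set la := (_ * _)%R.
have X0' := ltW X0.
have L0 : (0 < l ^+ d)%R by rewrite exprn_gt0.
have la0 : (0 <= la)%R by rewrite !mulr_ge0 ?powR_ge0.
have laE : (la `^ a = C * X * (t / l ^+ d) `^ (- k))%R.
  rewrite /la; move: (t / _)%R => y.
  rewrite !powRM ?powR_ge0 ?mulr_ge0 ?powR_ge0// -!powRrM.
  rewrite mulVf ?gt_eqF// !powRr1 ?(ltW C0)//.
  by congr (_ * _)%R; congr powR; field; rewrite gt_eqF.
apply: ereal_inf_lbound; split => /=; first by rewrite lee_fin.
have mH := measurable_hcube c l.
have mQ := measurable_ccube c l.
pose E := hcube c l `&` [set x | (la < v x)%R].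
have mv' p (B : set (Rd R d)) : measurable B ->
    measurable (B `&` [set x | (p < v x)%R]).
  move=> mB; rewrite (_ : [set _ | _] = v @^-1` `]p, +oo[%classic).
    rewrite -[X in measurable (_ `&` X)]setTI; apply: measurableI => //.
    by apply: mv => //; exact: measurable_itv.
  by apply/seteqP; split => x /=; rewrite in_itv/= andbT.
have mE : measurable E by exact: mv'.
(* The level set in the closed cube is replaced by its part in the half-open cube, where the decay
   is available; the faces are null. *)
have muS : mu [set x | la%:E < `|((EFin \o v) \_ (ccube c l)) x|] <= mu E.
  have SE : [set x | la%:E < `|((EFin \o v) \_ (ccube c l)) x|] =
      ccube c l `&` [set x | (la < v x)%R].
    apply/seteqP; split => x /=; rewrite patchE.
      case: ifPn => [/set_mem xQ|_]; last by rewrite abse0 lte_fin ltNge la0.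
      by rewrite abse_EFin lte_fin gtr0_norm.
    by move=> [xQ lv]; rewrite mem_set//= ?abse_EFin lte_fin gtr0_norm.
  rewrite SE; apply: (@le_trans _ _ (mu (E `|` (ccube c l `\` hcube c l)))).
    apply: le_measure; rewrite ?inE.
    - exact: mv'.
    - by apply: measurableU => //; exact: measurableD.
    - move=> x [xQ lv]; have [xH|xH] := pselect (hcube c l x); [by left|by right].
  apply: le_trans (measureU2 _ _ _) _ => //; first exact: measurableD.
  by rewrite [X in _ + X]ccubeD_null// adde0.
apply: le_trans muS _.
have muEfin : mu E \is a fin_num.
  rewrite ge0_fin_numE// (@le_lt_trans _ _ (mu (hcube c l)))//.
    by apply: le_measure; rewrite ?inE//; exact: subIsetl.
  by rewrite lebesgue_hcube// ltry.
rewrite -(fineK muEfin) lee_fin leNgt; apply/negP => tm.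
have := HC c l E l0 mE (@subIsetl _ _ _).
rewrite leNgt => /negP; apply.
apply: (@le_lt_trans _ _ ((C * (fine (mu E) / l ^+ d) `^ (1 - k))%:E * (X * l ^+ d)%:E)).
  rewrite lee_wpmul2l ?lee_fin ?mulr_ge0 ?powR_ge0 ?(ltW C0)//.
  by rewrite -IX; exact: (weight_integral_sub _ mH mQ (@sub_hcube_ccube _ _ c l)).
apply: (@lt_le_trans _ _ ((la `^ a)%:E * mu E)); last first.
  apply: (cst_le_integral mu mE (measurable_funTS (mvp _))); first exact: powR_ge0.
  move=> x [_ /= lv]; apply: ge0_ler_powR; rewrite ?nnegrE ?(ltW a0) ?(ltW lv)//.
  exact: ltW.
rewrite -(fineK muEfin) -!EFinM lte_fin laE.
set m := fine (mu E); have m0 : (0 < m)%R by exact: lt_trans tm.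
have mk : ((m / l ^+ d) `^ (1 - k) = m / l ^+ d * (m / l ^+ d) `^ (- k))%R.
  rewrite powRD; last by rewrite (gt_eqF (divr_gt0 m0 L0)) implybT.
  by rewrite powRr1// divr_ge0// ltW.
rewrite mk (_ : (C * (m / l ^+ d * (m / l ^+ d) `^ (- k)) * (X * l ^+ d) =
  C * X * (m / l ^+ d) `^ (- k) * m)%R); last by field; rewrite gt_eqF.
rewrite ltr_pM2r// ltr_pM2l ?mulr_gt0// !powRN ltf_pV2 ?posrE ?powR_gt0 ?divr_gt0//.
by apply: gt0_ltr_powR; rewrite ?nnegrE ?ltr_pM2r ?invr_gt0 ?divr_ge0 ?(ltW t0) ?(ltW m0) ?(ltW L0).
Qed.

Lemma rearr_weight0 c l t : (0 < l)%R -> (l ^+ d <= t)%R ->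
  decr_rearr mu ((EFin \o v) \_ (ccube c l)) t <= 0.
Proof.
move=> l0 lt; apply: ereal_inf_lbound; split => //=.
have mQ := measurable_ccube c l.
apply: (@le_trans _ _ (mu (ccube c l))); last by rewrite lebesgue_ccube// lee_fin.
apply: le_measure; rewrite ?inE.
- rewrite (_ : [set _ | _] = ccube c l)//; apply/seteqP; split => x /=; rewrite patchE.
    by case: ifPn => [/set_mem//|_]; rewrite abse0 ltxx.
  by move=> xQ; rewrite mem_set//= ?abse_EFin lte_fin gtr0_norm.
- exact: mQ.
- by move=> x /=; rewrite patchE; case: ifPn => [/set_mem//|_]; rewrite abse0 ltxx.
Qed.

End ainf.

(** * Rearrangements *)

Section powR_integral.
Context (R : realType).
Local Notation leb := (@lebesgue_measure R).

Lemma integral_powR_cc (g x y : R) : (0 < g)%R -> (0 < x)%R -> (x < y)%R ->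
  \int[leb]_(t in `[x, y]) (t `^ (g - 1))%:E = ((y `^ g - x `^ g) / g)%:E.
Proof.
move=> g0 x0 xy.
have dF t : (0 < t)%R -> derivable (fun t => t `^ g / g)%R t 1.
  by move=> t0; apply: derivableM => //; apply: derivable_powR; rewrite in_itv/= andbT.
have cF t : (0 < t)%R -> {for t, continuous (fun t => t `^ g / g)%R}.
  by move=> t0; apply: differentiable_continuous; exact/derivable1_diffP/dF.
have y0 := lt_trans x0 xy.
rewrite (@continuous_FTC2 _ _ (fun t => t `^ g / g)%R)//.
- by rewrite -EFinB -mulrBl.
- apply: derivable_within_continuous => t; rewrite in_itv/= => /andP[xt _].
  by apply: derivable_powR; rewrite in_itv/= andbT (lt_le_trans x0).
- split.
  + by move=> t; rewrite in_itv/= => /andP[xt _]; apply: dF; exact: lt_trans xt.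
  + exact/cvg_at_right_filter/cF.
  + exact/cvg_at_left_filter/cF.
- move=> t; rewrite in_itv/= => /andP[xt _]; have t0 := lt_trans x0 xt.
  have ti : t \in `]0%R, +oo[ by rewrite in_itv/= andbT.
  rewrite (@derive1Mr _ (fun t => t `^ g)%R) ?powR_derive1//.
    by field; rewrite gt_eqF.
  exact: derivable_powR.
Qed.

(** The integrand may blow up at 0, so the fundamental theorem is used on [[y / n.+2, y]] and [n]
    tends to infinity; the shift in [n.+2] keeps the left endpoint below [y]. *)
Lemma integral_powR (g y : R) : (0 < g)%R -> (0 < y)%R ->
  \int[leb]_(t in `]0%R, y[) (t `^ (g - 1))%:E <= (y `^ g / g)%:E.
Proof.
move=> g0 y0.
pose F n := `[(y / n.+2%:R)%R, y]%classic.
have mf : measurable_fun [set: R] (fun t : R => (t `^ (g - 1))%:E).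
  by apply/measurable_EFinP; exact: measurable_powR.
have FF : nondecreasing_seq F.
  move=> n m nm; apply/subsetPset => t; rewrite /F/= !in_itv/= => /andP[nt ->].
  by rewrite andbT (le_trans _ nt)// ler_pM2l// lef_pV2 ?posrE// ler_nat !ltnS.
have mF n : measurable (F n) by exact: measurable_itv.
have U : `]0%R, y[%classic `<=` \bigcup_n F n.
  move=> t /=; rewrite in_itv/= => /andP[t0 ty].
  have := archi_boundP (ltW (divr_gt0 y0 t0)); set N := Num.bound _ => tN.
  exists N => //; rewrite /F/= in_itv/= (ltW ty) andbT.
  rewrite ler_pdivrMr// mulrC -ler_pdivrMr// (le_trans (ltW tN))// ler_nat.
  exact: leq_trans (leqnSn _) (leqnSn _).
apply: (@le_trans _ _ (\int[leb]_(t in \bigcup_n F n) (t `^ (g - 1))%:E)).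
  apply: ge0_subset_integral => //; first exact: bigcupT_measurable.
    exact: measurable_funTS.
  by move=> t _; rewrite lee_fin powR_ge0.
have := @ge0_nondecreasing_set_cvg_integral _ (measurableTypeR R) R F
  (fun t => (t `^ (g - 1))%:E) leb FF mF (fun i => measurable_funTS mf).
move=> /(_ _)/wrap[]; first by move=> i x _; rewrite lee_fin powR_ge0.
move=> h; rewrite -(cvg_lim _ h)//.
apply: lime_le; first by apply/cvg_ex; eexists; exact: h.
near=> n; rewrite integral_powR_cc//.
- rewrite lee_fin ler_pM2r ?invr_gt0// gerBl powR_ge0//.
- by rewrite divr_gt0.
- by rewrite ltr_pdivrMr// ltr_pMr// ltr1n.
Unshelve. all: by end_near. Qed.

End powR_integral.

(** Preimages of upper rays under a nonincreasing function are intervals. *)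
Lemma nonincreasing_emeasurable (R : realType) (D : set R) (g : R -> \bar R) :
  measurable D -> (forall s t, (s <= t)%R -> g t <= g s) -> measurable_fun D g.
Proof.
move=> mD gni; apply: (measurability (@ErealGenCInfty.G R)) => [|/= _ [_] [r ->] <-].
  exact: ErealGenCInfty.measurableE.
apply: measurableI => //; apply: is_interval_measurable => s t/=.
rewrite !in_itv/= !andbT => fs ft u /andP[su ut].
by rewrite in_itv/= andbT (le_trans ft)// gni.
Qed.

Section rearrangement.
Context d (T : measurableType d) (R : realType) (mu : {measure set T -> \bar R}).
Variable f : T -> \bar R.
Local Notation leb := (@lebesgue_measure R).
Local Notation "f ^*" := (decr_rearr mu f).

Lemma decr_rearr_ge0 t : 0 <= f^* t.
Proof. by apply: le_ereal_inf_tmp => y [/= y0 _]. Qed.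

Lemma decr_rearr_nonincreasing (s t : R) : (s <= t)%R -> f^* t <= f^* s.
Proof.
move=> st; apply: ereal_inf_le_tmp => y [/= y0 yt]; split => //.
by rewrite (le_trans yt)// lee_fin.
Qed.

Lemma measurable_decr_rearr (D : set R) : measurable D ->
  measurable_fun D f^*.
Proof.
move=> mD; apply: nonincreasing_emeasurable => // s t.
exact: decr_rearr_nonincreasing.
Qed.

Lemma measurable_lorentz_integrand (a b : R) :
  measurable_fun (`]0%R, +oo[%classic : set R)
    (fun t : R => ((t `^ a^-1)%:E * f^* t) `^ b * (t^-1)%:E).
Proof.
have mD : measurable (`]0%R, +oo[%classic : set R) by exact: measurable_itv.
apply: emeasurable_funM; last first.
  apply: (eq_measurable_fun (fun t : R => (t `^ (-1))%:E)).
    move=> t; rewrite inE/= in_itv/= andbT => t0.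
    by rewrite powR_inv1 ?ltW.
  by apply/measurable_EFinP/measurable_funTS; exact: measurable_powR.
apply: (measurableT_comp (measurable_poweR _)).
apply: emeasurable_funM; last exact: measurable_decr_rearr.
by apply/measurable_EFinP/measurable_funTS; exact: measurable_powR.
Qed.

Lemma gt_decr_rearr (y t : R) : measurable_fun [set: T] f -> (0 <= y)%R ->
  t%:E < mu [set x | y%:E < `|f x|] -> y%:E < f^* t.
Proof.
move=> mf y0 tmu.
have mS (z : R) : measurable [set x | z%:E < `|f x|].
  rewrite -[X in measurable X]setTI; apply: emeasurable_fun_o_infty => //.
  exact: measurableT_comp.
pose S n := [set x | (y + n.+1%:R^-1)%:E < `|f x|].
have SU : \bigcup_n S n = [set x | y%:E < `|f x|].
  apply/seteqP; split => x /=.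
    by move=> [n _]; apply: le_lt_trans; rewrite lee_fin lerDl.
  suff yz (z : \bar R) : y%:E < z -> exists n, (y + n.+1%:R^-1)%:E < z.
    by move=> /yz[n]; exists n.
  case: z => [r| |//]; last by exists 0%N; rewrite ltry.
  rewrite lte_fin -subr_gt0 => yr.
  have := archi_boundP (ltW (divr_gt0 ltr01 yr)); set N := Num.bound _ => rN.
  exists N; rewrite lte_fin addrC -ltrBrDr -[ltRHS]invrK ltf_pV2 ?posrE ?invr_gt0//.
  by rewrite -div1r (lt_le_trans rN)// ler_nat.
have : mu (S n) @[n --> \oo] --> mu [set x | y%:E < `|f x|].
  rewrite -SU; apply: nondecreasing_cvg_mu => //.
  - by move=> n; exact: mS.
  - by rewrite SU.
  - move=> m n mn; apply/subsetPset => x; rewrite /S/=; apply: le_lt_trans.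
    by rewrite lee_fin lerD2l lef_pV2 ?posrE// ler_nat ltnS.
move=> cS; have [n tS] : exists n, t%:E < mu (S n).
  apply: contrapT => /forallNP nS; move: tmu; rewrite -(cvg_lim _ cS)// ltNge.
  move=> /negP; apply; apply: lime_le; first by apply/cvg_ex; eexists; exact: cS.
  by apply: nearW => n; rewrite leNgt; apply/negP/nS.
apply: (@lt_le_trans _ _ (y + n.+1%:R^-1)%:E); first by rewrite lte_fin ltrDl.
apply: le_ereal_inf_tmp => z [z0 zt]; rewrite leNgt; apply/negP => zy.
suff : mu (S n) <= t%:E by rewrite leNgt tS.
apply: le_trans zt; apply: le_measure; rewrite ?inE.
- exact: mS.
- case: z z0 zy => [z| |//] _ _; first exact: mS.
  rewrite (_ : [set _ | _] = set0)//; apply/seteqP; split => // x/=.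
  by rewrite ltNge leey.
- by move=> x /=; exact: lt_trans.
Qed.

End rearrangement.

(** Tonelli's theorem for the region below the graph of [h]: its vertical sections are intervals of
    length [h x], its horizontal ones the level sets. *)
Lemma layer_cake d (T : measurableType d) (R : realType)
    (m : {sigma_finite_measure set T -> \bar R}) (h : T -> \bar R) :
  measurable_fun [set: T] h -> (forall x, 0 <= h x) ->
  \int[m]_x h x = \int[lebesgue_measure]_(y in `]0%R, +oo[) m [set x | y%:E < h x].
Proof.
move=> mh h0.
pose A : set (T * measurableTypeR R) := [set z | (0 < z.2)%R /\ z.2%:E < h z.1].
have mA : measurable A.
  rewrite (_ : A = (snd @^-1` `]0%R, +oo[%classic) `&` [set z | (z.2)%:E < h z.1]).
    apply: measurableI.
      have mI : measurable (`]0%R, +oo[%classic : set (measurableTypeR R)).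
        exact: measurable_itv.
      by have := @measurable_snd _ _ T (measurableTypeR R) measurableT _ mI; rewrite setTI.
    rewrite -[X in measurable X]setTI.
    apply: (@measurable_lte _ _ _ setT measurableT
      (fun z : T * measurableTypeR R => z.2%:E) (fun z => h z.1)).
      by apply: measurableT_comp => //; exact: measurable_snd.
    exact: (measurableT_comp mh).
  by apply/seteqP; split => z /=; rewrite in_itv/= andbT.
have FG := indic_fubini_tonelli m (@lebesgue_measure R) mA.
rewrite indic_fubini_tonelli_FE// indic_fubini_tonelli_GE// in FG.
rewrite [RHS]integral_mkcond.
transitivity (\int[m]_x (lebesgue_measure \o xsection A) x).
  apply: eq_integral => x _ /=.
  rewrite (_ : xsection A x = [set y : R | (0 < y)%R /\ y%:E < h x]); last first.
    by apply/seteqP; split => y; rewrite /xsection/= inE.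
  case: (h x) (h0 x) => [r r0| _|//].
    rewrite (_ : [set _ | _] = `]0%R, r[%classic).
      rewrite lebesgue_measure_itv/= lte_fin lee_fin in r0 *.
      by case: ltP => [_|r0']; rewrite ?sube0//; congr EFin; apply/eqP; rewrite eq_le r0 r0'.
    by apply/seteqP; split => y /=; rewrite in_itv/= lte_fin => /andP.
  rewrite (_ : [set _ | _] = `]0%R, +oo[%classic).
    by rewrite lebesgue_measure_itv/= ltry.
  by apply/seteqP; split => y /=; rewrite in_itv/= ltry andbT => // -[].
rewrite FG; apply: eq_integral => y _ /=; rewrite patchE.
case: ifPn => [/set_mem|/negP]; rewrite ?inE /= in_itv/= andbT => y0.
  congr (m _); apply/seteqP; split => x; rewrite /ysection/= inE => //.
  by move=> [].
rewrite (_ : ysection A y = set0) ?measure0//; apply/seteqP; split => // x.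
by rewrite /ysection/= inE => -[].
Qed.

(** * Lorentz norms *)

Lemma lt_poweRVl (R : realType) (x : \bar R) (y a : R) : 0 <= x -> (0 <= y)%R ->
  (0 < a)%R -> (y%:E < x `^ a) = ((y `^ a^-1)%:E < x).
Proof.
move=> x0 y0 a0; case: x x0 => [x x0| _|//]; last first.
  by rewrite poweRyr ?gt_eqF// !ltry.
rewrite lee_fin in x0.
have aK z : (0 <= z)%R -> ((z `^ a) `^ a^-1 = z)%R.
  by move=> z0; rewrite -powRrM divff ?gt_eqF// powRr1.
have aK' z : (0 <= z)%R -> ((z `^ a^-1) `^ a = z)%R.
  by move=> z0; rewrite -powRrM mulVf ?gt_eqF// powRr1.
rewrite poweR_EFin !lte_fin; apply/idP/idP => yx.
  by rewrite -(aK x x0); apply: gt0_ltr_powR; rewrite ?invr_gt0 ?nnegrE ?powR_ge0.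
by rewrite -(aK' y y0); apply: gt0_ltr_powR; rewrite ?nnegrE ?powR_ge0.
Qed.

Section lorentz_bounds.
Context d (T : measurableType d) (R : realType).
Local Notation leb := (@lebesgue_measure R).
Local Notation pos := (`]0%R, +oo[%classic : set R).

Let mpos : measurable pos.
Proof. exact: measurable_itv. Qed.

(** One half of equimeasurability: layer cake on both sides reduces the claim to level sets, and
    that of the rearrangement at height [z] contains every positive [t] below the measure of that of
    [f]. *)
Lemma moment_le_rearr (mu : {sigma_finite_measure set T -> \bar R})
    (f : T -> \bar R) (a : R) :
  measurable_fun [set: T] f -> (forall x, 0 <= f x) -> (0 < a)%R ->
  \int[mu]_x f x `^ a <= \int[leb]_(t in pos) decr_rearr mu f t `^ a.
Proof.
move=> mf f0 a0; set g := decr_rearr mu f.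
have mg : measurable_fun pos (fun t => g t `^ a).
  apply: (measurableT_comp (measurable_poweR _)).
  exact: measurable_decr_rearr.
rewrite [leRHS]integral_mkcond.
rewrite (layer_cake mu); last 2 first.
- exact: (measurableT_comp (measurable_poweR _)).
- by move=> x; exact: poweR_ge0.
rewrite (@layer_cake _ (measurableTypeR R) R leb); last 2 first.
- exact/(measurable_restrictT _ mpos).
- by move=> x; apply: erestrict_ge0 => t _; exact: poweR_ge0.
have mlev (d' : measure_display) (T' : measurableType d')
    (m : {sigma_finite_measure set T' -> \bar R}) (h : T' -> \bar R) :
    measurable_fun setT h -> measurable_fun pos (fun y : R => m [set x | y%:E < h x]).
  move=> mh; have mS y : measurable [set x | y%:E < h x].
    by rewrite -[X in measurable X]setTI; exact: emeasurable_fun_o_infty.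
  apply: nonincreasing_emeasurable => // s t st; apply: le_measure; rewrite ?inE//.
  by move=> x /=; apply: le_lt_trans; rewrite lee_fin.
have mga : measurable_fun [set: R] ((fun t => g t `^ a) \_ pos).
  exact/(measurable_restrictT _ mpos).
apply: ge0_le_integral => //.
- apply: mlev; exact: (measurableT_comp (measurable_poweR _)).
- exact: mlev.
move=> y /=; rewrite in_itv/= andbT => y0.
set z := (y `^ a^-1)%R; have z0 : (0 <= z)%R by exact: powR_ge0.
have -> : [set x | y%:E < f x `^ a] = [set x | z%:E < `|f x|].
  by apply/seteqP; split => x /=; rewrite lt_poweRVl ?(ltW y0)// gee0_abs.
apply: (@le_trans _ _ (leb [set t : R | (0 < t)%R /\ t%:E < mu [set x | z%:E < `|f x|]])).
  have : 0 <= mu [set x | z%:E < `|f x|] by [].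
  case: (mu _) => [r r0|_|//].
    rewrite (_ : [set _ | _] = `]0%R, r[%classic).
      rewrite lebesgue_measure_itv/= lte_fin.
      by case: ltP => [_|r0']; rewrite ?sube0 ?lee_fin.
    by apply/seteqP; split => t /=; rewrite in_itv/= lte_fin => /andP.
  rewrite (_ : [set _ | _] = `]0%R, +oo[%classic).
    by rewrite lebesgue_measure_itv/= ltry.
  by apply/seteqP; split => t /=; rewrite in_itv/= ltry andbT => // -[].
apply: le_measure; rewrite ?inE.
- apply: is_interval_measurable => s t /= [s0 _] [_ t1] u /andP[su ut]; split.
    exact: lt_le_trans su.
  by apply: le_lt_trans t1; rewrite lee_fin.
- rewrite -[X in measurable X]setTI; exact: emeasurable_fun_o_infty.
- move=> t [t0 tmu] /=; rewrite patchE mem_set/= ?in_itv/= ?t0//.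
  by rewrite lt_poweRVl ?decr_rearr_ge0 ?(ltW y0)//; exact: gt_decr_rearr.
Qed.

Lemma lorentz_integrandE (a b t : R) (x : \bar R) : (0 < t)%R -> 0 <= x ->
  ((t `^ a^-1)%:E * x) `^ b * (t^-1)%:E = (t `^ (b / a - 1))%:E * x `^ b.
Proof.
move=> t0 x0; rewrite poweRM ?lee_fin ?powR_ge0// poweR_EFin -powRrM muleAC -EFinM.
by rewrite powRB ?(gt_eqF t0) ?implybT// powRr1 ?(ltW t0)// [(a^-1 * b)%R]mulrC.
Qed.

Lemma lorentz_norm_ge (mu : {sigma_finite_measure set T -> \bar R})
    (f : T -> \bar R) (a b : R) :
  measurable_fun [set: T] f -> (forall x, 0 <= f x) -> (0 < b)%R -> (b <= a)%R ->
  (\int[mu]_x f x `^ a) `^ a^-1 <=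
    ((a / b) `^ b^-1)%:E * lorentz_norm mu a b%:E f.
Proof.
move=> mf f0 b0 ba; have a0 := lt_le_trans b0 ba; rewrite /lorentz_norm.
set g := decr_rearr mu f; set S := \int[lebesgue_measure]_(_ in _) _.
have S0 : 0 <= S.
  by apply: integral_ge0 => t /=; rewrite in_itv/= andbT => t0;
    rewrite mule_ge0 ?poweR_ge0// lee_fin invr_ge0 ltW.
have ab0 : (0 < a / b)%R by rewrite divr_gt0.
have ba0 : (0 < b / a)%R by rewrite divr_gt0.
rewrite -poweR_EFin -poweRM ?mule_ge0 ?lee_fin ?(ltW ab0) ?(ltW ba0)//.
rewrite muleA -EFinM (_ : (a / b * (b / a) = 1)%R) ?mul1e; last first.
  by field; rewrite !gt_eqF.
suff SE : \int[mu]_x f x `^ a <= S `^ (a / b).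
  rewrite (_ : b^-1 = a / b * a^-1)%R; last by field; rewrite !gt_eqF.
  rewrite poweRrM; apply: gt0_ler_poweR => //.
  - by rewrite invr_ge0 ltW.
  - rewrite in_itv/= leey andbT; apply: integral_ge0 => x _; exact: poweR_ge0.
  - by rewrite in_itv/= leey poweR_ge0.
have gS (t : R) : (0 < t)%R -> ((t `^ a^-1)%:E * g t) `^ b <= S.
  move=> t0; have mt : measurable (`]0%R, t[%classic : set R) by exact: measurable_itv.
  have tpos : `]0%R, t[%classic `<=` pos.
    by move=> u /=; rewrite !in_itv/= andbT => /andP[].
  set P := _ `^ b.
  (* [P] is the integral over []0, t[] of the constant [P / t], which lies below the integrand since
     [g] is nonincreasing and the exponent [b / a - 1] is at most 0. *)
  have -> : P = \int[leb]_(u in `]0%R, t[) cst (P * (t^-1)%:E) u.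
    have lt : leb `]0%R, t[%classic = t%:E.
      by rewrite lebesgue_measure_itv/= lte_fin t0 sube0.
    rewrite integral_cst// [X in _ * X]lt.
    by rewrite -muleA -EFinM mulVf ?gt_eqF// mule1.
  apply: (@le_trans _ _ (\int[leb]_(u in `]0%R, t[)
      (((u `^ a^-1)%:E * g u) `^ b * (u^-1)%:E))).
    apply: ge0_le_integral => //.
    - by move=> u _; rewrite mule_ge0 ?poweR_ge0// lee_fin invr_ge0 ltW.
    - by apply: (measurable_funS mpos tpos); exact: measurable_lorentz_integrand.
    - move=> u /=; rewrite in_itv/= => /andP[u0 ut].
      rewrite /P !lorentz_integrandE ?decr_rearr_ge0//.
      apply: lee_pmul; rewrite ?lee_fin ?powR_ge0 ?poweR_ge0//.
        rewrite -opprB; apply: ler_powRN => //; last exact: ltW.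
        by rewrite subr_ge0 ler_pdivrMr// mul1r.
      apply: gt0_ler_poweR; rewrite ?in_itv/= ?leey ?andbT ?decr_rearr_ge0 ?(ltW b0)//.
      exact/decr_rearr_nonincreasing/ltW.
  apply: ge0_subset_integral => //; first exact: measurable_lorentz_integrand.
  move=> u /=; rewrite in_itv/= andbT => u0.
  by rewrite mule_ge0 ?poweR_ge0// lee_fin invr_ge0 ltW.
apply: le_trans (moment_le_rearr mu mf f0 a0) _; rewrite -/g.
have mI := measurable_lorentz_integrand mu f a b.
have SE : S = \int[leb]_(t in pos) (((t `^ a^-1)%:E * g t) `^ b * (t^-1)%:E) by [].
clearbody S; case: S S0 gS SE => [s s0 gS SE|_ _ _|//]; last first.
  by rewrite [leRHS]poweRyr ?gt_eqF// leey.
rewrite lee_fin in s0.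
apply: (@le_trans _ _ (\int[leb]_(t in pos) ((s `^ (a / b - 1))%:E *
    (((t `^ a^-1)%:E * g t) `^ b * (t^-1)%:E)))).
  apply: ge0_le_integral => //.
  - by move=> t _; exact: poweR_ge0.
  - by apply: (measurableT_comp (measurable_poweR _)); exact: measurable_decr_rearr.
  - exact: measurable_funeM.
  - move=> t /=; rewrite in_itv/= andbT => t0; have := gS t t0.
    (* An infinite [g t] would contradict the finite bound [gS]. *)
    case: (g t) (decr_rearr_ge0 mu f t : 0 <= g t) => [r r0|_|//]; last first.
      rewrite gt0_muley ?lte_fin ?powR_gt0// [X in X <= _]poweRyr ?gt_eqF//.
    rewrite -EFinM !poweR_EFin lee_fin => ps; rewrite -!EFinM lee_fin.
    rewrite lee_fin in r0; set p := (_ `^ b)%R in ps *.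
    have -> : (r `^ a = p `^ (a / b) * t^-1)%R.
      rewrite /p -powRrM (_ : (b * (a / b) = a)%R); last by field; rewrite gt_eqF.
      rewrite powRM ?powR_ge0// -powRrM mulVf ?gt_eqF// powRr1 ?(ltW t0)//.
      by field; rewrite gt_eqF.
    rewrite mulrA ler_wpM2r ?invr_ge0 ?(ltW t0)//.
    rewrite -{1}[(a / b)%R](subrK 1%R) powRD ?subrK ?(gt_eqF ab0)//.
    rewrite powRr1 ?powR_ge0// ler_wpM2r ?powR_ge0//.
    apply: ge0_ler_powR; rewrite ?nnegrE ?powR_ge0//.
    by rewrite subr_ge0 ler_pdivlMr// mul1r.
rewrite ge0_integralZl ?lee_fin ?powR_ge0//; last first.
  move=> t /=; rewrite in_itv/= andbT => t0.
  by rewrite mule_ge0 ?poweR_ge0// lee_fin invr_ge0 ltW.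
rewrite -SE poweR_EFin -EFinM lee_fin.
rewrite -{2}[s]powRr1// -powRD ?subrK// ?(gt_eqF ab0)//.
Qed.

(** A power [t]^ (- (k / a))[with]k < 1[, cut off at]L[, has finite norm for every second exponent,
    and scaling gives the factor]L [^ a^-1]. *)
Lemma lorentz_norm_le (mu : {measure set T -> \bar R}) (a k : R) (b : \bar R) :
  (0 < a)%R -> 1 <= b -> (0 < k < 1)%R -> exists2 C : R, (0 < C)%R &
  forall f (B L : R), (0 <= B)%R -> (0 < L)%R ->
    (forall t : R, (0 < t)%R -> decr_rearr mu f t <= (B * (t / L) `^ (- (k / a)))%:E) ->
    (forall t : R, (L <= t)%R -> decr_rearr mu f t <= 0) ->
  lorentz_norm mu a b f <= (C * B * L `^ a^-1)%:E.
Proof.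
move=> a0; case: b => [b| |//] b1 /andP[k0 k1]; last first.
  exists 1%R => // f B L B0 L0 gB g0; rewrite mul1r /lorentz_norm.
  apply: ge_ereal_sup => z [t /=]; rewrite in_itv/= andbT => t0 <-.
  have [tL|Lt] := ltP t L; last first.
    apply: (@le_trans _ _ 0); last by rewrite lee_fin mulr_ge0 ?powR_ge0.
    by rewrite mule_ge0_le0 ?lee_fin ?powR_ge0//; exact: g0.
  apply: (@le_trans _ _ ((t `^ a^-1)%:E * (B * (t / L) `^ (- (k / a)))%:E)).
    by rewrite lee_wpmul2l ?lee_fin ?powR_ge0//; exact: gB.
  rewrite -EFinM lee_fin mulrCA ler_wpM2l//.
  have y0 : (0 < t / L)%R by rewrite divr_gt0.
  have y1 : (t / L <= 1)%R by rewrite ler_pdivrMr// mul1r ltW.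
  (* The product equals [(t / L)]^ ((1 - k) / a) * L [^ a^-1], with base at most 1 and nonnegative
     exponent. *)
  rewrite -{1}[t](divfK (lt0r_neq0 L0)).
  rewrite powRM ?(ltW y0) ?(ltW L0)// mulrAC -powRD ?(gt_eqF y0) ?implybT//.
  rewrite ler_piMl ?powR_ge0// -(powRr0 (t / L)) ger_powR ?y0//.
  by rewrite -[X in (X - _)%R]mul1r -mulrBl mulr_ge0 ?invr_ge0 ?subr_ge0 ?(ltW a0) ?(ltW k1).
rewrite lee_fin in b1; have b0 := lt_le_trans ltr01 b1.
have c0 : (0 < 1 - k)%R by rewrite subr_gt0.
set ga := ((1 - k) * b / a)%R; have ga0 : (0 < ga)%R by rewrite divr_gt0 ?mulr_gt0.
exists ((1 - k)^-1 `^ b^-1)%R; first by rewrite powR_gt0 ?invr_gt0.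
move=> f B L B0 L0 gB g0; rewrite /lorentz_norm; set g := decr_rearr mu f.
have mL : measurable (`]0%R, L[%classic : set R) by exact: measurable_itv.
set c := (B `^ b * L `^ (k * b / a))%R.
have cge0 : (0 <= c)%R by rewrite mulr_ge0 ?powR_ge0.
have mpow : measurable_fun [set: R] (fun t : R => (t `^ (ga - 1))%:E).
  by apply/measurable_EFinP; exact: measurable_powR.
have SL : \int[leb]_(t in pos) (((t `^ a^-1)%:E * g t) `^ b * (t^-1)%:E) <=
    (B `^ b * L `^ (b / a) / ga)%:E.
  apply: (@le_trans _ _ (\int[leb]_(t in `]0%R, L[) (c%:E * (t `^ (ga - 1))%:E))).
    (* Both integrands are extended by zero to the line and compared pointwise; beyond [L] the
       rearrangement vanishes. *)
    rewrite [leRHS]integral_mkcond [leLHS]integral_mkcond.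
    apply: ge0_le_integral => //.
    - move=> t _; apply: erestrict_ge0 => {}t /=; rewrite in_itv/= andbT => t0.
      by rewrite mule_ge0 ?poweR_ge0// lee_fin invr_ge0 ltW.
    - by apply/(measurable_restrictT _ mpos); exact: measurable_lorentz_integrand.
    - apply/(measurable_restrictT _ mL); apply: measurable_funeM.
      exact: measurable_funTS.
    - move=> t _; rewrite !patchE; case: ifPn => [/set_mem|]; last first.
        move=> _; case: ifPn => // _; rewrite mule_ge0// lee_fin// powR_ge0//.
      rewrite /= in_itv/= andbT => t0; rewrite lorentz_integrandE ?decr_rearr_ge0//.
      have [tL|Lt] := ltP t L; last first.
        have -> : g t = 0 by apply/eqP; rewrite eq_le g0// decr_rearr_ge0.
        rewrite poweR0r ?gt_eqF// mule0; case: ifPn => // _.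
        by rewrite mule_ge0// lee_fin// powR_ge0.
      rewrite mem_set /= ?in_itv/= ?t0 ?tL//.
      apply: (@le_trans _ _ ((t `^ (b / a - 1))%:E *
          ((B * (t / L) `^ (- (k / a))) `^ b)%:E)).
        rewrite lee_wpmul2l ?lee_fin ?powR_ge0// -poweR_EFin.
        apply: gt0_ler_poweR; rewrite ?in_itv/= ?leey ?andbT ?decr_rearr_ge0 ?(ltW b0)//.
          by rewrite lee_fin mulr_ge0 ?powR_ge0.
        exact: gB.
      rewrite -!EFinM lee_fin /c powRM ?powR_ge0// -powRrM.
      rewrite powRM ?invr_ge0 ?(ltW t0) ?(ltW L0)//.
      rewrite -[(L^-1)%R]powR_inv1 ?(ltW L0)// -[((L `^ -1) `^ _)%R]powRrM.
      rewrite mulrA mulrCA -!mulrA ler_wpM2l ?powR_ge0// mulrA -powRD; last first.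
        by rewrite (gt_eqF t0) implybT.
      rewrite mulrC le_eqVlt; apply/orP; left; apply/eqP.
      by congr (_ `^ _ * _ `^ _)%R; rewrite /ga; field; rewrite gt_eqF.
  rewrite ge0_integralZl//; last 2 first.
  - exact: measurable_funTS.
  - by move=> t _; rewrite lee_fin powR_ge0.
  apply: (@le_trans _ _ (c%:E * (L `^ ga / ga)%:E)).
    by rewrite lee_wpmul2l ?lee_fin//; exact: integral_powR.
  rewrite -EFinM lee_fin /c !mulrA ler_pM2r ?invr_gt0// -!mulrA.
  rewrite -powRD ?(gt_eqF L0) ?implybT// le_eqVlt; apply/orP; left; apply/eqP.
  by congr (_ * _ `^ _)%R; rewrite /ga; field; rewrite gt_eqF.
have S0 : 0 <= \int[leb]_(t in pos) (((t `^ a^-1)%:E * g t) `^ b * (t^-1)%:E).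
  apply: integral_ge0 => t /=; rewrite in_itv/= andbT => t0.
  by rewrite mule_ge0 ?poweR_ge0// lee_fin invr_ge0 ltW.
have ba0 : (0 < b / a)%R by rewrite divr_gt0.
apply: (@le_trans _ _ (((b / a)%:E * (B `^ b * L `^ (b / a) / ga)%:E) `^ b^-1)).
  apply: gt0_ler_poweR; rewrite ?in_itv/= ?leey ?andbT ?mule_ge0 ?invr_ge0
    ?lee_fin ?(ltW b0) ?(ltW ba0)//.
    exact: divr_ge0 (mulr_ge0 (powR_ge0 _ _) (powR_ge0 _ _)) (ltW ga0).
  by rewrite lee_wpmul2l ?lee_fin ?(ltW ba0).
rewrite -EFinM poweR_EFin lee_fin.
rewrite (_ : (b / a * (B `^ b * L `^ (b / a) / ga) =
    (1 - k)^-1 * (B * L `^ a^-1) `^ b)%R); last first.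
  rewrite powRM ?powR_ge0// -powRrM [(a^-1 * b)%R]mulrC /ga.
  by field; rewrite !gt_eqF.
rewrite (@powRM _ (1 - k)^-1%R) ?invr_ge0 ?powR_ge0 ?(ltW c0)// -(powRrM (B * _)%R).
by rewrite divff ?gt_eqF// powRr1 ?mulr_ge0 ?powR_ge0// mulrA.
Qed.

End lorentz_bounds.

(** * Reduction to positive real weights *)

Section ae_invariance.
Context d (T : measurableType d) (R : realType) (mu : {measure set T -> \bar R}).
Hypothesis cmu : measure_is_complete mu.

Let le_level (f g : T -> \bar R) (y : \bar R) : measurable_fun [set: T] f ->
  measurable_fun [set: T] g -> ae_eq mu setT f g ->
  mu [set x | y < `|f x|] <= mu [set x | y < `|g x|].
Proof.
move=> mf mg [N [mN N0 fgN]].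
have mS (h : T -> \bar R) : measurable_fun [set: T] h -> measurable [set x | y < `|h x|].
  move=> mh; rewrite -[X in measurable X]setTI; apply: emeasurable_fun_o_infty => //.
  exact: measurableT_comp.
apply: (@le_trans _ _ (mu ([set x | y < `|g x|] `|` N))).
  apply: le_measure; rewrite ?inE.
  - exact: mS.
  - by apply: measurableU => //; exact: mS.
  - move=> x /= yf; have [xN|xN] := pselect (N x); [by right|left].
    suff -> : g x = f x by [].
    by apply/esym; apply: contrapT => fg; apply: xN; apply: fgN => /= /(_ I).
apply: le_trans (measureU2 _ _ _) _ => //; first exact: mS.
by rewrite [X in _ + X]N0 adde0.
Qed.

(** The level sets differ by null sets; completeness of [mu] makes [g] measurable. *)
Lemma decr_rearr_ae (f g : T -> \bar R) : measurable_fun [set: T] f ->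
  ae_eq mu setT f g -> decr_rearr mu f = decr_rearr mu g.
Proof.
move=> mf fg; have mg : measurable_fun [set: T] g by exact: ae_measurable_fun fg mf.
have gf : ae_eq mu setT g f by exact: ae_eq_sym.
apply/funext => t; rewrite /decr_rearr; congr ereal_inf; apply/seteqP.
split=> y [y0 yt]; split=> //; apply: le_trans yt.
  exact: (@le_level g f).
exact: (@le_level f g).
Qed.

Lemma lorentz_avg_ae (Q : set T) (a : R) (b : \bar R) (f g : T -> \bar R) :
  measurable Q -> measurable_fun [set: T] f -> ae_eq mu setT f g ->
  lorentz_avg mu Q a b f = lorentz_avg mu Q a b g.
Proof.
move=> mQ mf fg; rewrite /lorentz_avg /lorentz_norm.
have -> // : decr_rearr mu (f \_ Q) = decr_rearr mu (g \_ Q).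
apply: decr_rearr_ae.
  by apply/(measurable_restrictT _ mQ)/measurable_funTS.
move: fg => [N [mN N0 fgN]]; exists N; split => // x /= h; apply: fgN => /= fgx.
by apply: h => _; rewrite !patchE; case: ifP => // _; exact: fgx.
Qed.

Lemma lorentz_avg_ge0 (Q : set T) (a : R) (b : \bar R) (f : T -> \bar R) :
  0 <= lorentz_avg mu Q a b f.
Proof.
rewrite mule_ge0 ?poweR_ge0// /lorentz_norm.
case: b => [b| |//]; first exact: poweR_ge0.
apply: (@le_trans _ _ ((1 `^ a^-1)%R%:E * decr_rearr mu (f \_ Q) 1)).
  by rewrite mule_ge0 ?lee_fin ?powR_ge0// decr_rearr_ge0.
by apply: ereal_sup_ubound; exists 1%R => //=; rewrite in_itv/= ltr01.
Qed.

End ae_invariance.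

Section sigma_finite_Rd.
Context (R : realType) (d : nat).

HB.instance Definition _ := @Measure_isSigmaFinite.Build _ (Rd R d) R
  (@completed_measure_extension _ _ _ (@lebesgue_tuple R d))
  (completed_measure_extension_sigma_finite (sigma_finiteT (@lebesgue_tuple R d))).

(** The same measure as [lebesgue_Rd], packaged with the sigma-finiteness used by the layer cake
    formula. *)
Definition sigma_finite_lebesgue_Rd :
    {sigma_finite_measure set (Rd R d) -> \bar R} :=
  @completed_measure_extension _ _ _ (@lebesgue_tuple R d).

End sigma_finite_Rd.

(** * Comparison of power averages and Lorentz averages on cubes *)

Section averages.
Context (R : realType) (d : nat).
Local Notation mu := (lebesgue_Rd R d).
Implicit Types (v : Rd R d -> R) (a b : R).

Definition power_avg (Q : set (Rd R d)) v a : \bar R :=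
  ((mu Q)^-1 * \int[mu]_(x in Q) (v x `^ a)%:E) `^ a^-1.

Lemma lorentz_avg_le v a b K s : measurable_fun [set: Rd R d] v ->
  (forall x, 0 < v x)%R -> (0 < a)%R -> (0 < b)%R -> (0 < K)%R ->
  muckenhoupt v a b K -> 1 <= s ->
  exists2 C : R, (0 < C)%R & forall c l, (0 < l)%R ->
    lorentz_avg mu (ccube c l) a s (EFin \o v) <=
    C%:E * power_avg (ccube c l) v a.
Proof.
move=> mv v0 a0 b0 K0 HK s1.
have [C1 [k [C10 k01 rb]]] := rearr_weight_bound mv v0 a0 b0 K0 HK.
have [C2 C20 nb] := lorentz_norm_le mu a0 s1 k01.
exists (C2 * C1)%R; first exact: mulr_gt0.
move=> c l l0; have L0 : (0 < l ^+ d)%R by rewrite exprn_gt0.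
have [X [A [X0 A0 IX _ _]]] := weight_averages mv v0 a0 b0 K0 HK c l0.
rewrite /lorentz_avg /power_avg IX lebesgue_ccube// inver gt_eqF// -EFinM.
rewrite mulrCA mulVf ?gt_eqF// mulr1 !poweR_EFin.
(* The norm bound is used with [B = C1 * X]^ a^-1[and]L[the volume of the cube; the normalization of
   the average then cancels]L [^ a^-1]. *)
have := nb ((EFin \o v) \_ (ccube c l)) (C1 * X `^ a^-1)%R (l ^+ d)%R.
move=> /(_ _ L0 _ _)/wrap[||| nB].
- by rewrite mulr_ge0 ?powR_ge0 ?(ltW C10).
- by move=> t t0; exact: rb.
- by move=> t lt; exact: rearr_weight0.
apply: (@le_trans _ _ (((l ^+ d) `^ (- a^-1))%:E *
    (C2 * (C1 * X `^ a^-1) * (l ^+ d) `^ a^-1)%:E)).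
  by rewrite lee_wpmul2l ?lee_fin ?powR_ge0.
rewrite -!EFinM lee_fin powRN; have := powR_gt0 a^-1 L0.
by move: (_ `^ a^-1)%R (_ `^ a^-1)%R => x y y0; rewrite le_eqVlt; apply/orP; left;
  apply/eqP; field; rewrite gt_eqF.
Qed.

Lemma lorentz_avg_ge v a b (c : d.-tuple R) (l : R) :
  measurable_fun [set: Rd R d] v -> (forall x, 0 < v x)%R ->
  (0 < b)%R -> (b <= a)%R -> (0 < l)%R ->
  power_avg (ccube c l) v a <=
    ((a / b) `^ b^-1)%:E * lorentz_avg mu (ccube c l) a b%:E (EFin \o v).
Proof.
move=> mv v0 b0 ba l0; have a0 := lt_le_trans b0 ba.
have mQ := measurable_ccube c l.
have L0 : (0 < l ^+ d)%R by rewrite exprn_gt0.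
set f := (EFin \o v) \_ (ccube c l).
have mf : measurable_fun [set: Rd R d] f.
  by apply/(measurable_restrictT _ mQ)/measurable_funTS/measurable_EFinP.
have f0 x : 0 <= f x.
  by rewrite /f patchE; case: ifP => // _; rewrite lee_fin ltW.
have := @lorentz_norm_ge _ _ _ (sigma_finite_lebesgue_Rd R d) f a b mf f0 b0 ba.
rewrite -/(lorentz_norm mu a b%:E f) => nf.
rewrite /power_avg /lorentz_avg.
have IE : \int[mu]_(x in ccube c l) (v x `^ a)%:E = \int[mu]_x f x `^ a.
  rewrite integral_mkcond; apply: eq_integral => x _; rewrite /f !patchE.
  by case: ifP => // _; rewrite poweR0r// gt_eqF.
rewrite IE poweRM; last 2 first.
- by rewrite lebesgue_ccube// inver gt_eqF// lee_fin invr_ge0 ltW.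
- by apply: integral_ge0 => x _; exact: poweR_ge0.
have LE : ((l ^+ d)^-1 `^ a^-1 = (l ^+ d) `^ (- a^-1))%R.
  by rewrite -(powR_inv1 (ltW L0)) -powRrM mulN1r.
rewrite lebesgue_ccube// inver gt_eqF// !poweR_EFin LE.
by rewrite muleCA lee_wpmul2l ?lee_fin ?powR_ge0.
Qed.

End averages.

(** * Real representatives of weights and finiteness of suprema over cubes *)

Section real_weights.
Context (R : realType) (d : nat).
Local Notation mu := (lebesgue_Rd R d).

Lemma complete_lebesgue_Rd : measure_is_complete mu.
Proof. exact: measure_is_complete_caratheodory. Qed.

Lemma weight_ae_real (w : Rd R d -> \bar R) : weight w ->
  exists v : Rd R d -> R, [/\ measurable_fun [set: Rd R d] v,
    (forall x, 0 < v x)%R,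
    measurable_fun [set: Rd R d] (fun x => (v x)^-1)%R,
    ae_eq mu setT w (EFin \o v) &
    ae_eq mu setT (fun x => (w x)^-1) (EFin \o (fun x => (v x)^-1)%R)].
Proof.
move=> [mw [N [mN N0 wN]]].
(* The default value 1, taken on a null set, keeps [v] and its inverse positive and finite
   everywhere. *)
pose v x : R := if 0 < w x < +oo then fine (w x) else 1%R.
have v0 x : (0 < v x)%R.
  rewrite /v; case: ifPn => // /andP[w0 woo].
  by rewrite -lte_fin fineK// gt0_fin_numE.
have wv : ae_eq mu setT w (EFin \o v).
  exists N; split => // x /= h; apply: wN => /= w0.
  by apply: h => _; rewrite /v w0 fineK// gt0_fin_numE; case/andP: w0.
have mv : measurable_fun [set: Rd R d] v.
  by apply/measurable_EFinP; exact: (ae_measurable_fun complete_lebesgue_Rd wv).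
exists v; split; [exact: mv|exact: v0| |exact: wv|].
  rewrite (_ : (fun _ => _) = fun x => (v x `^ (-1))%R); last first.
    by apply/funext => x; rewrite powR_inv1// ltW.
  exact: (measurableT_comp (measurable_powR _)).
move: wv => [M [mM M0 wM]]; exists M; split => // x /= h; apply: wM => /= wx.
by apply: h => _; rewrite wx//= inver gt_eqF.
Qed.

Lemma integral_poweR_ae (w : Rd R d -> \bar R) (v : Rd R d -> R) (Q : set (Rd R d)) r :
  measurable Q -> measurable_fun [set: Rd R d] w -> measurable_fun [set: Rd R d] v ->
  ae_eq mu setT w (EFin \o v) ->
  \int[mu]_(x in Q) w x `^ r = \int[mu]_(x in Q) (v x `^ r)%:E.
Proof.
move=> mQ mw mv [N [mN N0 wN]]; apply: ae_eq_integral.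
- exact: mQ.
- by apply: measurable_funTS; exact: (measurableT_comp (measurable_poweR _)).
- apply: measurable_funTS; apply/measurable_EFinP.
  exact: (measurableT_comp (measurable_powR _)).
- exists N; split => // x /= h; apply: wN => /= wx; apply: h => _.
  by rewrite wx.
Qed.

Lemma ereal_sup_cube_ltyP (F : set (Rd R d) -> \bar R) :
  ereal_sup [set F Q | Q in @cube R d] < +oo <->
  exists2 K : R, (0 < K)%R & forall c l, (0 < l)%R -> F (ccube c l) <= K%:E.
Proof.
split=> [Foo|[K K0 FK]]; last first.
  apply: (@le_lt_trans _ _ K%:E); last exact: ltry.
  by apply: ge_ereal_sup => z [Q [c [l [l0 ->]]] <-]; exact: FK.
have FM c l : (0 < l)%R -> F (ccube c l) <= ereal_sup [set F Q | Q in @cube R d].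
  by move=> l0; apply: ereal_sup_ubound; exists (ccube c l) => //; exists c, l.
move: Foo FM; case: (ereal_sup _) => [M _ FM|//|_ FM].
  (* The maximum with 1 makes the bound positive. *)
  exists (Num.max 1 M)%R; first by rewrite lt_max ltr01.
  by move=> c l l0; rewrite (le_trans (FM c l l0))// lee_fin le_max lexx orbT.
by exists 1%R => // c l l0; rewrite (le_trans (FM c l l0))// leNye.
Qed.

Lemma invr_powR (x p : R) : (0 <= x)%R -> (x^-1 `^ p = x `^ (- p))%R.
Proof. by move=> x0; rewrite -(powR_inv1 x0) -powRrM mulN1r. Qed.

End real_weights.

(** * Comparison of the Muckenhoupt and Lorentz weight classes *)

Theorem theorem3p10 (R : realType) (d : nat) (hd : (0 < d)%N)
    (p q : R) (r s : \bar R)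
    (hp : (1 < p)%R) (hpq : (p <= q)%R) (hr : 1 <= r) (hs : 1 <= s) :
  (@A_pq R d p q `<=` @A_lorentz R d p r q s) /\
  (s <= q%:E -> p%:E <= r -> @A_lorentz R d p r q s = @A_pq R d p q).
Proof.
have p0 : (0 < p)%R by exact: lt_trans hp.
have q0 : (0 < q)%R by exact: lt_le_trans hpq.
have p10 : (0 < p - 1)%R by rewrite subr_gt0.
have p'E : conj_exp p = (p / (p - 1))%R.
  rewrite /conj_exp /hoelder_conjugate /= eqe gt_eqF//= -EFinB inver gt_eqF//.
set p' := conj_exp p in p'E *.
have p'0 : (0 < p')%R by rewrite p'E divr_gt0.
pose mu := lebesgue_Rd R d.
(* [P] and [L] are the quantities bounded in [A_pq] and [A_lorentz], written for a real
   representative; [APE] and [ALE] justify the change. *)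
pose P (v : Rd R d -> R) Q := power_avg Q v q * power_avg Q (fun x => (v x)^-1)%R p'.
pose L (v : Rd R d -> R) Q := lorentz_avg mu Q q s (EFin \o v) *
  lorentz_avg mu Q p' (hoelder_conjugate r) (EFin \o (fun x => (v x)^-1)%R).
have v'0 (v : Rd R d -> R) : (forall x, 0 < v x)%R -> forall x, (0 < (v x)^-1)%R.
  by move=> v0 x; rewrite invr_gt0.
have avgV (v : Rd R d -> R) Q b : (forall x, 0 < v x)%R ->
    \int[mu]_(x in Q) (v x `^ (- b))%:E = \int[mu]_(x in Q) ((v x)^-1 `^ b)%:E.
  by move=> v0; apply: eq_integral => x _; rewrite invr_powR// ltW.
have APE (w : Rd R d -> \bar R) (v : Rd R d -> R) : weight w ->
    measurable_fun [set: Rd R d] v ->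
    (forall x, 0 < v x)%R -> ae_eq mu setT w (EFin \o v) ->
    A_pq p q w <-> exists2 K : R, (0 < K)%R &
      forall c l, (0 < l)%R -> P v (ccube c l) <= K%:E.
  move=> Ww mv v0 wv; have [mw _] := Ww.
  have PE c l : ((mu (ccube c l))^-1 * \int[mu]_(x in ccube c l) w x `^ q) `^ q^-1 *
      ((mu (ccube c l))^-1 * \int[mu]_(x in ccube c l) w x `^ (- p')) `^ p'^-1 =
      P v (ccube c l).
    have mQ := measurable_ccube c l.
    rewrite /P /power_avg; congr ((_ * _) `^ _ * (_ * _) `^ _).
      exact: (integral_poweR_ae q mQ mw mv wv).
    by rewrite (integral_poweR_ae (- p')%R mQ mw mv wv) avgV.
  split=> [[_ /ereal_sup_cube_ltyP[K K0 PK]]|[K K0 PK]].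
    by exists K => // c l l0; rewrite -PE; exact: PK.
  split => //; apply/ereal_sup_cube_ltyP; exists K => // c l l0.
  by apply: le_trans (PK c l l0); rewrite -PE.
have ALE (w : Rd R d -> \bar R) (v : Rd R d -> R) : weight w ->
    measurable_fun [set: Rd R d] v ->
    measurable_fun [set: Rd R d] (fun x => (v x)^-1)%R ->
    ae_eq mu setT w (EFin \o v) ->
    ae_eq mu setT (fun x => (w x)^-1) (EFin \o (fun x => (v x)^-1)%R) ->
    A_lorentz p r q s w <-> exists2 K : R, (0 < K)%R &
      forall c l, (0 < l)%R -> L v (ccube c l) <= K%:E.
  move=> Ww mv mv' wv wv'; have [mw _] := Ww.
  have LE c l : lorentz_avg mu (ccube c l) q s w *
      lorentz_avg mu (ccube c l) p' (hoelder_conjugate r) (fun x => (w x)^-1) =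
      L v (ccube c l).
    have mQ := measurable_ccube c l.
    have mEv' : measurable_fun [set: Rd R d] (EFin \o (fun x => (v x)^-1)%R).
      exact/measurable_EFinP/mv'.
    have Lw := lorentz_avg_ae (@complete_lebesgue_Rd R d) q s mQ mw wv.
    have Lw' := lorentz_avg_ae (@complete_lebesgue_Rd R d) p'
      (hoelder_conjugate r) mQ mEv' (ae_eq_sym wv').
    exact (f_equal2 mule Lw (esym Lw')).
  split=> [[_ /ereal_sup_cube_ltyP[K K0 LK]]|[K K0 LK]].
    exists K; first exact: K0.
    move=> c l l0; exact (eq_ind _ (fun z => z <= K%:E) (LK c l l0) _ (LE c l)).
  split; first exact: Ww.
  apply/ereal_sup_cube_ltyP; exists K; first exact: K0.
  move=> c l l0.
  exact (eq_ind _ (fun z => z <= K%:E) (LK c l l0) _ (esym (LE c l))).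
have AL : A_pq p q `<=` A_lorentz (d := d) p r q s.
  move=> w Aw; have [Ww _] := Aw.
  have [v [mv v0 mv' wv wv']] := weight_ae_real Ww.
  have [K K0 PK] := (APE w v Ww mv v0 wv).1 Aw.
  apply/(ALE w v) => //.
  have HK1 : muckenhoupt v q p' K.
    move=> c l l0.
    exact (eq_ind _ (fun z => power_avg (ccube c l) v q *
      ((mu (ccube c l))^-1 * z) `^ p'^-1 <= K%:E) (PK c l l0) _ (esym (avgV _ _ _ v0))).
  (* The same bound read for [v^-1], with the exponents exchanged, so that the upper estimate
     applies to the second factor. *)
  have HK2 : muckenhoupt (fun x => (v x)^-1)%R p' q K.
    have avgVV Q : \int[mu]_(x in Q) (v x `^ q)%:E =
        \int[mu]_(x in Q) ((v x)^-1 `^ (- q))%:E.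
      by apply: eq_integral => x _; rewrite invr_powR ?opprK// ltW.
    move=> c l l0; have := PK c l l0; rewrite /P muleC => PK'.
    exact (eq_ind _ (fun z => power_avg (ccube c l) (fun x => (v x)^-1)%R p' *
      ((mu (ccube c l))^-1 * z) `^ q^-1 <= K%:E) PK' _ (avgVV _)).
  have [C1 C10 L1] := lorentz_avg_le mv v0 q0 p'0 K0 HK1 hs.
  have [C2 C20 L2] :=
    lorentz_avg_le mv' (v'0 _ v0) p'0 q0 K0 HK2 (hoelder_conj_ge1 hr).
  exists (C1 * C2 * K)%R => [|c l l0]; first by rewrite !mulr_gt0.
  apply: (@le_trans _ _ ((C1 * C2)%:E * P v (ccube c l))); last first.
    by rewrite [leRHS]EFinM lee_wpmul2l ?lee_fin ?mulr_ge0 ?(ltW C10) ?(ltW C20)//; exact: PK.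
  rewrite /P EFinM muleACA; apply: lee_pmul; [| |exact: L1|exact: L2];
    exact: lorentz_avg_ge0.
split=> // sq pr; apply/seteqP; split => // w Aw; have [Ww _] := Aw.
have [v [mv v0 mv' wv wv']] := weight_ae_real Ww.
have [K K0 LK] := (ALE w v Ww mv mv' wv wv').1 Aw.
apply/(APE w v) => //.
(* The bounds [1 <= s <= q] make [s] real. *)
have [s' s'0 sE] : exists2 s' : R, (0 < s' <= q)%R & s = s'%:E.
  case: s hs sq {L ALE AL LK Aw} => [s'| |]//; rewrite !lee_fin => s1 s'q.
  by exists s'; rewrite // s'q (lt_le_trans ltr01).
(* Conjugation reverses [p <= r], so the conjugate of [r] is a real number at most [p']; it is 1 for
   [r = +oo]. Thus the lower Lorentz estimate is available for both factors. *)
have [r' r'0 rE] : exists2 r' : R, (0 < r' <= p')%R & hoelder_conjugate r = r'%:E.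
  case: r hr pr {L ALE AL LK Aw} => [r'| |]// => [_|_ _].
    rewrite lee_fin => pr'; have r1 := lt_le_trans hp pr'.
    exists (r' / (r' - 1))%R; last first.
      rewrite /hoelder_conjugate /= eqe gt_eqF ?(lt_trans ltr01)//.
      by rewrite -EFinB inver gt_eqF ?subr_gt0.
    have r10 : (0 < r' - 1)%R by rewrite subr_gt0.
    apply/andP; split; first by rewrite divr_gt0// (lt_trans ltr01 r1).
    by rewrite p'E ler_pdivrMr// mulrAC ler_pdivlMr//; lra.
  exists 1%R; last by rewrite hoelder_conjugatey.
  by rewrite ltr01 p'E ler_pdivlMr// mul1r; lra.
case/andP: s'0 => s'0 s'q; case/andP: r'0 => r'0 r'p.
pose D1 := ((q / s') `^ s'^-1)%R; pose D2 := ((p' / r') `^ r'^-1)%R.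
have D10 : (0 < D1)%R by rewrite powR_gt0 ?divr_gt0.
have D20 : (0 < D2)%R by rewrite powR_gt0 ?divr_gt0.
exists (D1 * D2 * K)%R => [|c l l0]; first by rewrite !mulr_gt0.
apply: (@le_trans _ _ ((D1 * D2)%:E * L v (ccube c l))); last first.
  by rewrite [leRHS]EFinM lee_wpmul2l ?lee_fin ?mulr_ge0 ?(ltW D10) ?(ltW D20)//; exact: LK.
rewrite /P /L sE rE EFinM muleACA; apply: lee_pmul; rewrite ?poweR_ge0//.
- exact: lorentz_avg_ge.
- by apply: lorentz_avg_ge => //; exact: v'0.
Qed.
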